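(* Let $\mathcal{C}$ be a Frobenius exact category with stable category $\underline{\mathcal{C}}$. The assignments $$\underline{\mathcal{M}}\mapsto \mathcal{M}^{\perp}\qquad\text{and}\qquad \mathcal{H}\mapsto \underline{\mathcal{H}\cap{}^{\perp}\mathcal{H}}$$ give mutually inverse bijections between the following classes: (1) Silting subcategories $\underline{\mathcal{M}}$ of $\underline{\mathcal{C}}$ with $Proj(\mathcal{C})\subseteq\mathcal{M}$. (2) Subcategories $\mathcal{H}$ of $\mathcal{C}$ which are specially covariantly finite and coresolving in $\mathcal{C}$, such that $\check{\mathcal{H}}=\mathcal{C}$ and such that for any $H\in\mathcal{H}$ there exists a positive integer $t\geq 1$ with $\mathrm{Ext}_{\mathcal{C}}^{i}(H,\mathcal{H})=0$ (i.e. $\mathrm{Ext}^i_{\mathcal{C}}(H,H')=0$ for all $H'\in\mathcal{H}$) for all $i\geq t$.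
   Context: A Frobenius exact category is an exact category (in the sense of Quillen) with enough projectives and enough injectives in which projectives and injectives coincide. $Proj(\mathcal{C})$ and $Inj(\mathcal{C})$ denote the subcategories of projective and injective objects. ''Subcategory'' always means full additive subcategory closed under isomorphisms and direct summands. The stable category $\underline{\mathcal{C}}$ has the same objects as $\mathcal{C}$ and morphisms those of $\mathcal{C}$ modulo the morphisms factoring through projectives, with Happel's triangulated structure (shift $A[1]$ given by a conflation $A\to I\to A[1]$ with $I$ injective). For a subcategory $\mathcal{M}\supseteq Proj(\mathcal{C})$, $\underline{\mathcal{M}}$ is the full subcategory of $\underline{\mathcal{C}}$ on the objects of $\mathcal{M}$. $\mathrm{Ext}^i_{\mathcal{C}}$ denotes the Ext groups of the exact category $\mathcal{C}$. For a subcategory $\mathcal{X}$: $\mathcal{X}^{\perp}=\{Y\in\mathcal{C}\mid\mathrm{Ext}^{i}_{\mathcal{C}}(X,Y)=0\ \forall i\ge1,\forall X\in\mathcal{X}\}$ and ${}^{\perp}\mathcal{X}=\{Y\in\mathcal{C}\mid\mathrm{Ext}^{i}_{\mathcal{C}}(Y,X)=0\ \forall i\ge1,\forall X\in\mathcal{X}\}$. $\mathcal{H}$ is coresolving if it contains $Inj(\mathcal{C})$ and is closed under extensions and cones of inflations (for a conflation $A\to B\to C$: $A,C\in\mathcal{H}$ implies $B\in\mathcal{H}$; $A,B\in\mathcal{H}$ implies $C\in\mathcal{H}$). $\mathcal{H}$ is specially covariantly finite in $\mathcal{C}$ if for every $C\in\mathcal{C}$ there is a conflation $C\to H\to K$ with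 $H\in\mathcal{H}$ and $\mathrm{Ext}^1_{\mathcal{C}}(K,\mathcal{H})=0$. $\check{\mathcal{H}}$ is the class of objects $C$ such that for some $n\ge0$ there are conflations $K_i\to H_{-i}\to K_{i+1}$ ($0\le i\le n-1$) with $K_0=C$, $K_n=H_{-n}$ and all $H_{-i}\in\mathcal{H}$, $0\le i\le n$ (for $n=0$: $C\cong H_0$). A subcategory $\mathcal{S}$ of a triangulated category $\mathcal{T}$ is silting if $\mathrm{Hom}_{\mathcal{T}}(\mathcal{S},\mathcal{S}[i])=0$ for all $i>0$ and $\mathcal{T}$ is the smallest triangulated subcategory of $\mathcal{T}$ containing $\mathcal{S}$ and closed under direct summands and isomorphisms. *)

(* Defs.v *)
From HB Require Import structures.
From mathcomp Require Import all_boot all_algebra.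
From mathcomp Require Import mathcomp_extra boolp classical_sets functions.

Set Implicit Arguments.
Unset Strict Implicit.
Unset Printing Implicit Defensive.

Import GRing.Theory.
Import Quotient.

Local Open Scope classical_set_scope.
Local Open Scope quotient_scope.
Local Open Scope ring_scope.

Declare Scope cat_scope.
Delimit Scope cat_scope with cat.
Local Open Scope cat_scope.

Reserved Notation "g ∘ f" (at level 40, left associativity).

(** * Additive categories *)

Record preaddcat := PreAddCat {
  ob :> Type;
  hom : ob -> ob -> zmodType;
  idm : forall A, hom A A;
  comp : forall A B C, hom B C -> hom A B -> hom A C;
  compA : forall A B C D (h : hom C D) (g : hom B C) (f : hom A B),
    comp h (comp g f) = comp (comp h g) f;
  comp1m : forall A B (f : hom A B), comp (idm B) f = f;
  compm1 : forall A B (f : hom A B), comp f (idm A) = f;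
  compDl : forall A B C (g g' : hom B C) (f : hom A B),
    comp (g + g') f = comp g f + comp g' f;
  compDr : forall A B C (g : hom B C) (f f' : hom A B),
    comp g (f + f') = comp g f + comp g f'
}.
Arguments hom {p} A B.
Arguments idm {p} A.
Arguments comp {p A B C} g f.
Notation "g ∘ f" := (comp g f) : cat_scope.

Definition isom (C : preaddcat) (A B : C) (f : hom A B) : Prop :=
  exists g : hom B A, g ∘ f = idm A /\ f ∘ g = idm B.

Definition isomorphic (C : preaddcat) (A B : C) : Prop :=
  exists f : hom A B, isom f.

Definition is_zero (C : preaddcat) (Z : C) : Prop :=
  (forall (X : C) (f : hom X Z), f = 0) /\ (forall (X : C) (f : hom Z X), f = 0).

Definition is_biprod (C : preaddcat) (A B S : C) : Prop :=
  exists (i : hom A S) (j : hom B S) (p : hom S A) (q : hom S B),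
    [/\ p ∘ i = idm A, q ∘ j = idm B, p ∘ j = 0, q ∘ i = 0
      & i ∘ p + j ∘ q = idm S].

Record addcat := AddCat {
  add_cat :> preaddcat;
  has_zero : exists Z : add_cat, is_zero Z;
  has_biprod : forall A B : add_cat, exists S : add_cat, is_biprod A B S
}.

(* Full subcategories are given by their class of objects. *)
Record subcategory (C : addcat) (S : set C) : Prop := Subcategory {
  subcat_zero : forall Z : C, is_zero Z -> S Z;
  subcat_sum : forall A B X : C, is_biprod A B X -> S A -> S B -> S X;
  subcat_iso : forall A B : C, isomorphic A B -> S A -> S B;
  subcat_summand : forall A B X : C, is_biprod A B X -> S X -> S A
}.

(** * Exact categories *)

Section Universal.
Variable C : preaddcat.

Definition is_kernel (A B D : C) (f : hom A B) (g : hom B D) : Prop :=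
  g ∘ f = 0 /\
  forall (X : C) (h : hom X B), g ∘ h = 0 -> exists! k : hom X A, f ∘ k = h.

Definition is_cokernel (A B D : C) (f : hom A B) (g : hom B D) : Prop :=
  g ∘ f = 0 /\
  forall (X : C) (h : hom B X), h ∘ f = 0 -> exists! k : hom D X, k ∘ g = h.

Definition is_pushout (A B A' Q : C) (f : hom A B) (u : hom A A')
    (f' : hom A' Q) (u' : hom B Q) : Prop :=
  u' ∘ f = f' ∘ u /\
  forall (X : C) (a : hom A' X) (b : hom B X), b ∘ f = a ∘ u ->
    exists! k : hom Q X, k ∘ f' = a /\ k ∘ u' = b.

Definition is_pullback (Q B' B D : C) (g' : hom Q B') (v' : hom Q B)
    (v : hom B' D) (g : hom B D) : Prop :=
  g ∘ v' = v ∘ g' /\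
  forall (X : C) (a : hom X B') (b : hom X B), g ∘ b = v ∘ a ->
    exists! k : hom X Q, g' ∘ k = a /\ v' ∘ k = b.

Variable E : forall A B D : C, hom A B -> hom B D -> Prop.

Definition inflation_of (A B : C) (f : hom A B) : Prop :=
  exists (D : C) (g : hom B D), E f g.

Definition deflation_of (B D : C) (g : hom B D) : Prop :=
  exists (A : C) (f : hom A B), E f g.

(* Quillen's axioms, in the equivalent form due to Keller. *)
Record exact_structure : Prop := ExactStructure {
  exact_kernel : forall A B D (f : hom A B) (g : hom B D),
    E f g -> is_kernel f g /\ is_cokernel f g;
  exact_iso : forall A B D A' B' D' (f : hom A B) (g : hom B D)
      (f' : hom A' B') (g' : hom B' D')
      (a : hom A A') (b : hom B B') (d : hom D D'),
    isom a -> isom b -> isom d -> b ∘ f = f' ∘ a -> d ∘ g = g' ∘ b ->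
    E f g -> E f' g';
  exact_infl_id : forall A : C, inflation_of (idm A);
  exact_defl_id : forall A : C, deflation_of (idm A);
  exact_infl_comp : forall A B D (g : hom B D) (f : hom A B),
    inflation_of f -> inflation_of g -> inflation_of (g ∘ f);
  exact_defl_comp : forall A B D (g : hom B D) (f : hom A B),
    deflation_of f -> deflation_of g -> deflation_of (g ∘ f);
  exact_pushout : forall A B A' (f : hom A B) (u : hom A A'),
    inflation_of f ->
    exists (Q : C) (f' : hom A' Q) (u' : hom B Q),
      is_pushout f u f' u' /\ inflation_of f';
  exact_pullback : forall B' B D (v : hom B' D) (g : hom B D),
    deflation_of g ->
    exists (Q : C) (g' : hom Q B') (v' : hom Q B),
      is_pullback g' v' v g /\ deflation_of g'
}.

End Universal.

Record excat := ExCat {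
  ex_cat :> addcat;
  confl : forall A B D : ex_cat, hom A B -> hom B D -> Prop;
  exactP : exact_structure confl
}.
Arguments confl {e A B D} f g.

Definition Proj (C : excat) : set C := [set P | forall (A B D : C)
  (f : hom A B) (g : hom B D) (h : hom P D), confl f g ->
  exists k : hom P B, g ∘ k = h].

Definition Inj (C : excat) : set C := [set I | forall (A B D : C)
  (f : hom A B) (g : hom B D) (h : hom A I), confl f g ->
  exists k : hom B I, k ∘ f = h].

Arguments Proj : clear implicits.
Arguments Inj : clear implicits.

Record proj_pres (C : excat) (X : C) := ProjPres {
  pp_syz : C;
  pp_cover : C;
  pp_incl : hom pp_syz pp_cover;
  pp_map : hom pp_cover X;
  pp_confl : confl pp_incl pp_map;
  pp_proj : Proj C pp_cover
}.

Record inj_pres (C : excat) (X : C) := InjPres {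
  ip_hull : C;
  ip_cosyz : C;
  ip_map : hom X ip_hull;
  ip_proj : hom ip_hull ip_cosyz;
  ip_confl : confl ip_map ip_proj;
  ip_inj : Inj C ip_hull
}.

Record frobcat := FrobCat {
  frob_cat :> excat;
  enough_proj : forall X : frob_cat, $| proj_pres X |;
  enough_inj : forall X : frob_cat, $| inj_pres X |;
  frob_projinj : Proj frob_cat = Inj frob_cat
}.

(** * Elementary facts *)

Section Basics.
Variable C : preaddcat.

Lemma comp0m (A B D : C) (f : hom A B) : (0 : hom B D) ∘ f = 0.
Proof. by apply: (addrI (0 ∘ f)); rewrite -compDl !addr0. Qed.

Lemma compm0 (A B D : C) (g : hom B D) : g ∘ (0 : hom A B) = 0.
Proof. by apply: (addrI (g ∘ 0)); rewrite -compDr !addr0. Qed.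

Lemma compNl (A B D : C) (g : hom B D) (f : hom A B) : (- g) ∘ f = - (g ∘ f).
Proof. by apply: (addrI (g ∘ f)); rewrite -compDl !subrr comp0m. Qed.

Lemma compNr (A B D : C) (g : hom B D) (f : hom A B) : g ∘ (- f) = - (g ∘ f).
Proof. by apply: (addrI (g ∘ f)); rewrite -compDr !subrr compm0. Qed.

Lemma compBl (A B D : C) (g g' : hom B D) (f : hom A B) :
  (g - g') ∘ f = g ∘ f - g' ∘ f.
Proof. by rewrite compDl compNl. Qed.

Lemma compBr (A B D : C) (g : hom B D) (f f' : hom A B) :
  g ∘ (f - f') = g ∘ f - g ∘ f'.
Proof. by rewrite compDr compNr. Qed.

End Basics.

Section ExactBasics.
Variable C : excat.

Lemma confl_comp0 (A B D : C) (f : hom A B) (g : hom B D) :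
  confl f g -> g ∘ f = 0.
Proof. by move=> /(exact_kernel (exactP C))[[]]. Qed.

Lemma confl_coker (A B D X : C) (f : hom A B) (g : hom B D) (h : hom B X) :
  confl f g -> h ∘ f = 0 -> exists k : hom D X, k ∘ g = h.
Proof.
move=> /(exact_kernel (exactP C))[_ [_ cokg]] /cokg[k [kg _]].
by exists k.
Qed.

Lemma confl_epi (A B D X : C) (f : hom A B) (g : hom B D) (k k' : hom D X) :
  confl f g -> k ∘ g = k' ∘ g -> k = k'.
Proof.
move=> fg kk'; have [_ [gf0 cokg]] := exact_kernel (exactP C) fg.
have [|l [_ uniql]] := cokg _ (k ∘ g); first by rewrite -compA gf0 compm0.
by rewrite -(uniql k) // (uniql k').
Qed.

Lemma Proj_zero (Z : C) : is_zero Z -> Proj C Z.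
Proof.
move=> [_ Z0] A B D f g h _; exists 0.
by rewrite compm0 [RHS]Z0.
Qed.

Lemma Proj_biprod (P Q S : C) : is_biprod P Q S ->
  Proj C P -> Proj C Q -> Proj C S.
Proof.
move=> [i [j [p [q [_ _ _ _ ipjq]]]]] projP projQ A B D f g h fg.
have [k gk] := projP _ _ _ _ _ (h ∘ i) fg.
have [l gl] := projQ _ _ _ _ _ (h ∘ j) fg.
exists (k ∘ p + l ∘ q).
by rewrite compDr !compA gk gl -!compA -compDr ipjq compm1.
Qed.

(* The subgroup of morphisms that factor through a projective object. *)
Definition thruproj (A B : C) (f : hom A B) : bool :=
  `[< exists (P : C) (a : hom A P) (b : hom P B), Proj C P /\ f = b ∘ a >].

Lemma thruproj_zmod (A B : C) : zmod_closed (@thruproj A B).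
Proof.
split=> [|f g /asboolP[P [a [b [projP ->]]]] /asboolP[Q [c [d [projQ ->]]]]].
  have [Z Z0] := has_zero C; apply/asboolP; exists Z, 0, 0.
  by split; [exact: Proj_zero | rewrite comp0m].
have [S PQS] := has_biprod P Q; have projS := Proj_biprod PQS projP projQ.
have [i [j [p [q [pi qj pj qi _]]]]] := PQS.
apply/asboolP; exists S, (i ∘ a + j ∘ c), (b ∘ p - d ∘ q); split=> //.
rewrite compBl !compDr -!compA !(compA p) !(compA q) pi qj pj qi !comp1m !comp0m.
by rewrite !compm0 addr0 add0r.
Qed.

HB.instance Definition _ (A B : C) :=
  GRing.isZmodClosed.Build (hom A B) (@thruproj A B) (thruproj_zmod A B).

Lemma thruproj_compl (A B D : C) (g : hom B D) (f : hom A B) :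
  f \in @thruproj A B -> g ∘ f \in @thruproj A D.
Proof.
move=> /asboolP[P [a [b [projP ->]]]]; apply/asboolP.
by exists P, a, (g ∘ b); rewrite compA.
Qed.

Lemma thruproj_compr (A B D : C) (g : hom B D) (f : hom A B) :
  g \in @thruproj B D -> g ∘ f \in @thruproj A D.
Proof.
move=> /asboolP[P [a [b [projP ->]]]]; apply/asboolP.
by exists P, (a ∘ f), b; rewrite compA.
Qed.

End ExactBasics.
Arguments thruproj {C} A B.

(** * Ext groups *)

(* Ext^n(X, Y) is the n-th cohomology group of Hom(P, Y), where P is the
   projective resolution of X obtained by splicing chosen conflations
   syz Z -> cover Z -> Z with Z = X, syz X, syz (syz X), and so on. *)
Section Ext.
Variable C : frobcat.

Definition pres (X : C) : proj_pres X := unsquash (enough_proj X).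
Definition syz (X : C) : C := pp_syz (pres X).
Definition cover (X : C) : C := pp_cover (pres X).
Definition resol (X : C) (n : nat) : C := cover (iter n syz X).
Definition resol_diff (X : C) (n : nat) : hom (resol X n.+1) (resol X n) :=
  pp_incl (pres (iter n syz X)) ∘ pp_map (pres (iter n.+1 syz X)).

Variables (n : nat) (X Y : C).

Definition is_cocycle (f : hom (resol X n) Y) : bool :=
  f ∘ resol_diff X n == 0.

Lemma cocycle_zmod : zmod_closed is_cocycle.
Proof.
split=> [|f g /eqP f0 /eqP g0]; first by rewrite unfold_in /is_cocycle comp0m.
by rewrite unfold_in /is_cocycle compBl f0 g0 subrr.
Qed.

HB.instance Definition _ :=
  GRing.isZmodClosed.Build (hom (resol X n) Y) is_cocycle cocycle_zmod.

Record cocycle := Cocycle {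
  cocycle_val :> hom (resol X n) Y;
  _ : cocycle_val \in is_cocycle
}.
HB.instance Definition _ := [isSub for cocycle_val].
HB.instance Definition _ := [Choice of cocycle by <:].
HB.instance Definition _ := [SubChoice_isSubZmodule of cocycle by <:].

End Ext.

Definition is_coboundary (C : frobcat) (n : nat) (X Y : C) :
    hom (resol X n) Y -> Prop :=
  match n with
  | 0 => fun f => f = 0
  | m.+1 => fun f => exists g : hom (resol X m) Y, f = g ∘ resol_diff X m
  end.

Section ExtGroup.
Variables (C : frobcat) (n : nat) (X Y : C).

Definition coboundary (f : cocycle n X Y) : bool :=
  `[< is_coboundary (f : hom (resol X n) Y) >].

Lemma coboundary_zmod : zmod_closed coboundary.
Proof.
rewrite /coboundary; case: n => [|m]; split.
- exact/asboolP.
- by move=> f g /asboolP/= f0 /asboolP/= g0; apply/asboolP => /=; rewrite f0 g0 subrr.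
- by apply/asboolP; exists 0; rewrite comp0m.
- move=> f g /asboolP/=[f' ff'] /asboolP/=[g' gg']; apply/asboolP => /=.
  by exists (f' - g'); rewrite compBl ff' gg'.
Qed.

HB.instance Definition _ :=
  GRing.isZmodClosed.Build (cocycle n X Y) coboundary coboundary_zmod.

Definition Ext : zmodType := 
  {quot GRing.ZmodClosed.clone _ coboundary _}.

End ExtGroup.

Definition Ext_zero (C : frobcat) (n : nat) (X Y : C) : Prop :=
  forall e : Ext n X Y, e = 0.

(** * Categories with a shift and a class of triangles *)

(* This is the data of a triangulated category. The axioms on triangles are not
   recorded: they hold in the stable category of a Frobenius category
   (Happel), and the notion of a silting subcategory does not refer to them. *)
Record tricat := TriCat {
  tri_cat :> addcat;
  shift : tri_cat -> tri_cat;
  shiftm : forall A B : tri_cat, hom A B -> hom (shift A) (shift B);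
  shiftm1 : forall A : tri_cat, shiftm (idm A) = idm (shift A);
  shiftmM : forall (A B D : tri_cat) (g : hom B D) (f : hom A B),
    shiftm (g ∘ f) = shiftm g ∘ shiftm f;
  shiftmD : forall (A B : tri_cat) (f g : hom A B),
    shiftm (f + g) = shiftm f + shiftm g;
  distinguished : forall A B D : tri_cat,
    hom A B -> hom B D -> hom D (shift A) -> Prop
}.
Arguments shift {t} A.
Arguments distinguished {t A B D} u v w.

(* As the shift is an autoequivalence, closure under the inverse shift amounts,
   for a class closed under isomorphisms, to [thick_unshift]. *)
Record thick (T : tricat) (N : set T) : Prop := Thick {
  thick_subcat : subcategory N;
  thick_shift : forall A : T, N A -> N (shift A);
  thick_unshift : forall A : T, N (shift A) -> N A;
  thick_cone : forall (A B D : T)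
      (u : hom A B) (v : hom B D) (w : hom D (shift A)),
    distinguished u v w -> N A -> N B -> N D
}.

Record silting (T : tricat) (S : set T) : Prop := Silting {
  silting_subcat : subcategory S;
  silting_hom0 : forall (i : nat) (A B : T), (0 < i)%N -> S A -> S B ->
    forall f : hom A (iter i shift B), f = 0;
  silting_gen : smallest (@thick T) S = setT
}.

(** * The stable category *)

Section StablePreadd.
Variable C : excat.

Definition shom (A B : C) : zmodType := 
  {quot GRing.ZmodClosed.clone _ (thruproj A B) _}.

Definition stab (A B : C) (f : hom A B) : shom A B := \pi f.

Lemma stab_eq (A B : C) (f g : hom A B) :
  (stab f = stab g) <-> (f - g \in thruproj A B).
Proof. by rewrite /stab idealrBE; split=> /eqP. Qed.

Lemma stabK (A B : C) (f : shom A B) : stab (repr f) = f.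
Proof. exact: reprK. Qed.

Lemma stabD (A B : C) (f g : hom A B) : stab (f + g) = stab f + stab g.
Proof. exact: raddfD. Qed.

Lemma stab0 (A B : C) : stab (0 : hom A B) = 0.
Proof. exact: raddf0. Qed.

Definition scomp (A B D : C) (g : shom B D) (f : shom A B) : shom A D :=
  stab (repr g ∘ repr f).

Lemma stab_comp (A B D : C) (g : hom B D) (f : hom A B) :
  stab (g ∘ f) = scomp (stab g) (stab f).
Proof.
apply/stab_eq; set g' := repr _; set f' := repr _.
have gg' : g - g' \in thruproj B D by apply/stab_eq; rewrite stabK.
have ff' : f - f' \in thruproj A B by apply/stab_eq; rewrite stabK.
have -> : g ∘ f - g' ∘ f' = (g - g') ∘ f + g' ∘ (f - f').
  by rewrite compBl compBr addrA subrK.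
by apply: rpredD; [exact: thruproj_compr | exact: thruproj_compl].
Qed.

Definition stable_preadd : preaddcat.
Proof.
refine (@PreAddCat C shom (fun A => stab (idm A)) scomp _ _ _ _ _).
- move=> A B D E h g f; rewrite -(stabK h) -(stabK g) -(stabK f).
  by rewrite -!stab_comp compA.
- by move=> A B f; rewrite -(stabK f) -stab_comp comp1m.
- by move=> A B f; rewrite -(stabK f) -stab_comp compm1.
- move=> A B D g g' f; rewrite -(stabK g) -(stabK g') -(stabK f).
  by rewrite -stabD -!stab_comp compDl stabD.
- move=> A B D g f f'; rewrite -(stabK g) -(stabK f) -(stabK f').
  by rewrite -stabD -!stab_comp compDr stabD.
Defined.

Definition stable_add : addcat.
Proof.
refine (@AddCat stable_preadd _ _).
- have [Z [Zl Zr]] := has_zero C; exists Z; split=> X f.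
    by rewrite -(stabK f) [repr f]Zl stab0.
  by rewrite -(stabK f) [repr f]Zr stab0.
- move=> A B; have [S [i [j [p [q [pi qj pj qi ipjq]]]]]] := has_biprod A B.
  exists S, (stab i), (stab j), (stab p), (stab q).
  by split; rewrite /= -!stab_comp ?pi ?qj ?pj ?qi ?stab0 // -stabD ipjq.
Defined.

End StablePreadd.

Section Stable.
Variable C : frobcat.

Definition ipres (X : C) : inj_pres X := unsquash (enough_inj X).
Definition hull (X : C) : C := ip_hull (ipres X).
Definition cosyz (X : C) : C := ip_cosyz (ipres X).
Definition hull_in (X : C) : hom X (hull X) := ip_map (ipres X).
Definition hull_out (X : C) : hom (hull X) (cosyz X) := ip_proj (ipres X).

(* For some h, (f, h, g) is a morphism from X -> hull X -> cosyz X
   to Y -> hull Y -> cosyz Y. *)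
Definition lifts_to (X Y : C) (f : hom X Y) (g : hom (cosyz X) (cosyz Y)) : Prop :=
  exists h : hom (hull X) (hull Y),
    h ∘ hull_in X = hull_in Y ∘ f /\ hull_out Y ∘ h = g ∘ hull_out X.

Lemma lifts_toP (X Y : C) (f : hom X Y) : exists g, lifts_to f g.
Proof.
have [h hE] := ip_inj (hull_in Y ∘ f) (ip_confl (ipres X)).
have [|g gE] := confl_coker (h := hull_out Y ∘ h) (ip_confl (ipres X)).
  by rewrite -compA hE compA (confl_comp0 (ip_confl (ipres Y))) comp0m.
by exists g, h.
Qed.

Lemma lifts_to_uniq (X Y : C) (f f' : hom X Y) g g' :
  lifts_to f g -> lifts_to f' g' -> stab f = stab f' -> stab g = stab g'.
Proof.
move=> [h [hf hg]] [h' [hf' hg']] /stab_eq/asboolP[P [a [b [projP ffE]]]].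
have injP : Inj C P by rewrite -frob_projinj.
have [a' a'E] := injP _ _ _ _ _ a (ip_confl (ipres X)).
have [|s sE] :=
    confl_coker (h := h - h' - hull_in Y ∘ b ∘ a') (ip_confl (ipres X)).
  rewrite !compBl -[ip_map _]/(hull_in X) hf hf' -!compA a'E -compBr ffE.
  by rewrite subrr.
apply/stab_eq/asboolP; exists (hull Y), s, (hull_out Y); split.
  by rewrite frob_projinj; exact: ip_inj.
apply: (confl_epi (ip_confl (ipres X))); rewrite -compA sE !compBr !compA.
by rewrite (confl_comp0 (ip_confl (ipres Y))) !comp0m subr0 hg hg' compBl.
Qed.

Definition cosyzm (X Y : C) (f : hom X Y) : hom (cosyz X) (cosyz Y) :=
  sval (cid (lifts_toP f)).

Lemma cosyzmP (X Y : C) (f : hom X Y) : lifts_to f (cosyzm f).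
Proof. exact: svalP. Qed.

Definition sshift (X Y : C) (f : shom X Y) : shom (cosyz X) (cosyz Y) :=
  stab (cosyzm (repr f)).

Lemma sshiftE (X Y : C) (f : hom X Y) g : lifts_to f g -> sshift (stab f) = stab g.
Proof.
by move=> fg; apply: (lifts_to_uniq (cosyzmP _) fg); rewrite stabK.
Qed.

(* Happel's standard triangle of u, with Q the pushout of u and hull_in A;
   w is the morphism with w u' = hull_out A and w v = 0. *)
Definition standard_triangle (A B Q : C)
    (u : hom A B) (v : hom B Q) (w : hom Q (cosyz A)) : Prop :=
  exists u' : hom (hull A) Q,
    [/\ is_pushout (hull_in A) u v u', w ∘ u' = hull_out A & w ∘ v = 0].

Let S := stable_add C.

(* Triangles isomorphic in the stable category to a standard one *)
Definition stable_distinguished (A B D : S)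
    (u : hom A B) (v : hom B D) (w : hom D (cosyz A : S)) : Prop :=
  exists (A' B' D' : C) (u' : hom A' B') (v' : hom B' D')
      (w' : hom D' (cosyz A'))
      (a : hom (A : S) (A' : S)) (b : hom (B : S) (B' : S))
      (d : hom (D : S) (D' : S)),
    [/\ standard_triangle u' v' w', [/\ isom a, isom b & isom d]
      & [/\ b ∘ u = (stab u' : hom (A' : S) (B' : S)) ∘ a,
            d ∘ v = (stab v' : hom (B' : S) (D' : S)) ∘ b
          & (sshift a : hom (cosyz A : S) (cosyz A' : S)) ∘ w
              = (stab w' : hom (D' : S) (cosyz A' : S)) ∘ d]].

Definition stable : tricat.
Proof.
refine (@TriCat S cosyz sshift _ _ _ stable_distinguished).
- move=> A; apply: sshiftE; exists (idm _).
  by rewrite !comp1m !compm1.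
- move=> A B D g f; rewrite -(stabK g) -(stabK f) /= -stab_comp.
  have [h [hf hg]] := cosyzmP (repr f); have [k [kf kg]] := cosyzmP (repr g).
  rewrite (sshiftE (cosyzmP (repr g))) (sshiftE (cosyzmP (repr f))) -stab_comp.
  by apply: sshiftE; exists (k ∘ h); rewrite -compA hf !compA kf kg -!compA hg.
- move=> A B f g; rewrite -(stabK g) -(stabK f) /= -stabD.
  have [h [hf hg]] := cosyzmP (repr f); have [k [kf kg]] := cosyzmP (repr g).
  rewrite (sshiftE (cosyzmP (repr g))) (sshiftE (cosyzmP (repr f))) -stabD.
  apply: sshiftE; exists (h + k).
  by rewrite !compDl !compDr hf hg kf kg.
Defined.

(* [stable] has the same objects as [C], so these two are mutually inverse:
   [ununderline S] is the unique class M with S = underline M. *)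
Definition underline (M : set C) : set stable := M.
Definition ununderline (S : set stable) : set C := S.

End Stable.

(** * The two classes *)

Section Classes.
Variable C : frobcat.

Definition rperp (X : set C) : set C :=
  [set Y | forall i A, (1 <= i)%N -> X A -> Ext_zero i A Y].

Definition lperp (X : set C) : set C :=
  [set Y | forall i A, (1 <= i)%N -> X A -> Ext_zero i Y A].

Record coresolving (H : set C) : Prop := Coresolving {
  cores_inj : Inj C `<=` H;
  cores_ext : forall (A B D : C) (f : hom A B) (g : hom B D),
    confl f g -> H A -> H D -> H B;
  cores_cone : forall (A B D : C) (f : hom A B) (g : hom B D),
    confl f g -> H A -> H B -> H D
}.

Definition specially_covariantly_finite (H : set C) : Prop :=
  forall X : C, exists (Y K : C) (f : hom X Y) (g : hom Y K),
    [/\ confl f g, H Y & forall Z, H Z -> Ext_zero 1 K Z].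

Definition check (H : set C) : set C :=
  [set X | exists (n : nat) (K Y : nat -> C),
    [/\ isomorphic X (K 0%N), K n = Y n, forall i, (i <= n)%N -> H (Y i)
      & forall i, (i < n)%N ->
          exists (f : hom (K i) (Y i)) (g : hom (Y i) (K i.+1)), confl f g]].

Definition silting_class : set (set (stable C)) :=
  [set S | exists M : set C,
    [/\ subcategory M, Proj C `<=` M, S = underline M & silting S]].

Definition coresolving_class : set (set C) :=
  [set H | [/\ subcategory H, specially_covariantly_finite H, coresolving H,
    check H = setT &
    forall A, H A -> exists2 t : nat, (1 <= t)%N &
      forall i B, (t <= i)%N -> H B -> Ext_zero i A B]].

End Classes.

Definition inverse_bijections (T U : Type) (A : set T) (B : set U)
    (f : T -> U) (g : U -> T) : Prop :=
  [/\ set_fun A B f, set_fun B A g, {in A, cancel f g} & {in B, cancel g f}].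

(* Main.v *)
(* For [i > 0], Ext^i(X, Y) vanishes iff Hom(X, Y[i]) does in the stable category.

   From M to H: let G be the class generated by the objects m[j], with m in M and
   [j >= 0], under extensions and direct summands. Rigidity gives G inside
   M^perp and, by induction on the generation of X, a conflation X1 -> m -> X
   with m in M and X1 in G for each X in G; for a summand of an object Z this
   step only uses the complement, so no idempotent has to be split. As the X
   with X[n] in G for some n form a thick class, this holds for every X, and
   peeling off n such conflations yields X -> Y -> K with Y in G and K in the
   left perp of M^perp. Hence M^perp = G, which is specially covariantly finite,
   and such sequences split when Ext^1 vanishes, which recovers M.

   From H to M: a special preenvelope of the syzygy of A in H gives, by pushout,
   a conflation Y -> X -> A with Y in H and X in M. Each such step lowers by one
   the bound on the degrees of the nonzero Ext groups from A to H, so H lies in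
   the thick closure of M, and then so does C, being the check of H. Finally
   M^perp = G, which is contained in H. *)

Require Import Defs.
From mathcomp Require Import all_boot all_algebra.
From mathcomp Require Import mathcomp_extra boolp classical_sets functions.

Set Implicit Arguments.
Unset Strict Implicit.
Unset Printing Implicit Defensive.

Import GRing.Theory Defs.

Local Open Scope classical_set_scope.
Local Open Scope ring_scope.
Local Open Scope cat_scope.

(** * Additive and exact categories *)

Section Preadditive.
Variable C : preaddcat.
Implicit Types A B D S X Y Z : C.

Definition hom0 A B : Prop := forall f : hom A B, f = 0.

Lemma is_zero_id Z : is_zero Z <-> idm Z = 0.
Proof.
split=> [[Z0 _]|Z0]; [exact: Z0|split=> X f].
  by rewrite -(comp1m f) Z0 comp0m.
by rewrite -(compm1 f) Z0 compm0.
Qed.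

Lemma hom0_retract_l A B S (i : hom A S) (p : hom S A) :
  p ∘ i = idm A -> hom0 S B -> hom0 A B.
Proof. by move=> pi SB f; rewrite -(compm1 f) -pi compA (SB (f ∘ p)) comp0m. Qed.

Lemma hom0_retract_r A B S (i : hom B S) (p : hom S B) :
  p ∘ i = idm B -> hom0 A S -> hom0 A B.
Proof. by move=> pi SB f; rewrite -(comp1m f) -pi -compA (SB (i ∘ f)) compm0. Qed.

Lemma is_zero_summand A B S : is_biprod A B S -> is_zero S -> is_zero A.
Proof.
move=> [i [j [p [q [pi _ _ _ _]]]]] [S0 _].
by apply/is_zero_id; rewrite -pi (S0 _ i) compm0.
Qed.

Lemma hom0_isol A A' B : isomorphic A A' -> hom0 A B -> hom0 A' B.
Proof. by move=> [f [g [_ fg]]]; apply: hom0_retract_l fg. Qed.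

Lemma hom0_isor A B B' : isomorphic B B' -> hom0 A B -> hom0 A B'.
Proof. by move=> [f [g [_ fg]]]; apply: hom0_retract_r fg. Qed.

Lemma hom0_biprodl A A' S B : is_biprod A A' S ->
  hom0 A B -> hom0 A' B -> hom0 S B.
Proof.
move=> [i [j [p [q [_ _ _ _ e]]]]] h h' f.
by rewrite -(compm1 f) -e compDr !compA (h (f ∘ i)) (h' (f ∘ j)) !comp0m addr0.
Qed.

Lemma hom0_biprodr A B B' S : is_biprod B B' S ->
  hom0 A B -> hom0 A B' -> hom0 A S.
Proof.
move=> [i [j [p [q [_ _ _ _ e]]]]] h h' f.
by rewrite -(comp1m f) -e compDl -!compA (h (p ∘ f)) (h' (q ∘ f)) !compm0 addr0.
Qed.

Lemma isom_idm A : isom (idm A).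
Proof. by exists (idm A); rewrite comp1m. Qed.

Lemma isomorphic_refl A : isomorphic A A.
Proof. by exists (idm A); apply: isom_idm. Qed.

Lemma isomorphic_sym A B : isomorphic A B -> isomorphic B A.
Proof. by move=> [f [g [gf fg]]]; exists g, f. Qed.

Lemma isomorphic_trans A B D :
  isomorphic A B -> isomorphic B D -> isomorphic A D.
Proof.
move=> [f [g [gf fg]]] [f' [g' [gf' fg']]]; exists (f' ∘ f), (g ∘ g'); split.
  by rewrite compA -(compA g) gf' compm1.
by rewrite compA -(compA f') fg compm1.
Qed.

Lemma biprod_sym A B S : is_biprod A B S -> is_biprod B A S.
Proof.
move=> [i [j [p [q [pi qj pj qi e]]]]]; exists j, i, q, p.
by split=> //; rewrite addrC.
Qed.

Lemma biprod_uniq A B S S' :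
  is_biprod A B S -> is_biprod A B S' -> isomorphic S S'.
Proof.
move=> [i [j [p [q [pi qj pj qi e]]]]] [i' [j' [p' [q' [pi' qj' pj' qi' e']]]]].
exists (i' ∘ p + j' ∘ q), (i ∘ p' + j ∘ q'); split.
  rewrite compDr !compDl -!compA !(compA p') !(compA q') pi' qj' pj' qi'.
  by rewrite !comp1m !comp0m !compm0 addr0 add0r.
rewrite compDr !compDl -!compA !(compA p) !(compA q) pi qj pj qi.
by rewrite !comp1m !comp0m !compm0 addr0 add0r.
Qed.

Lemma biprod_isor A B S S' :
  isomorphic S S' -> is_biprod A B S -> is_biprod A B S'.
Proof.
move=> [f [g [gf fg]]] [i [j [p [q [pi qj pj qi e]]]]].
exists (f ∘ i), (f ∘ j), (p ∘ g), (q ∘ g); split.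
- by rewrite compA -(compA p) gf compm1.
- by rewrite compA -(compA q) gf compm1.
- by rewrite compA -(compA p) gf compm1.
- by rewrite compA -(compA q) gf compm1.
- by rewrite !compA -!(compA f) -compDr -compDl e comp1m fg.
Qed.

Lemma biprod_zero A Z : is_zero Z -> is_biprod A Z A.
Proof.
move=> Z0; exists (idm A), 0, (idm A), 0.
rewrite !comp1m !compm0 comp0m; split=> //; first by case: Z0.
by rewrite addr0.
Qed.

Lemma biprod_zerol A B S : is_zero A -> is_biprod A B S -> isomorphic S B.
Proof.
move=> A0 /biprod_uniq; apply; apply: biprod_sym; exact: biprod_zero.
Qed.

End Preadditive.

Section Subcategories.
Variable C : addcat.
Implicit Types N : set C.

Lemma subcategory_setI N N' :
  subcategory N -> subcategory N' -> subcategory (N `&` N').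
Proof.
move=> sN sN'; split.
- by move=> Z Z0; split; apply: subcat_zero.
- by move=> A B X AB [? ?] [? ?]; split; apply: (subcat_sum _ AB).
- by move=> A B AB [? ?]; split; apply: (subcat_iso _ AB).
- by move=> A B X AB [? ?]; split; apply: (subcat_summand _ AB).
Qed.

(** If [A] and [B] are isomorphic, [A] is a biproduct of [B] and a zero object, so closure under
    summands already gives closure under isomorphism. *)
Lemma subcategory_summand N :
  (forall Z, is_zero Z -> N Z) ->
  (forall A B X : C, is_biprod A B X -> N A -> N B -> N X) ->
  (forall A B X : C, is_biprod A B X -> N X -> N A) -> subcategory N.
Proof.
move=> N0 NS Ns; split=> // A B AB; have [Z Z0] := has_zero C.
exact/Ns/(biprod_isor (isomorphic_sym AB) (biprod_zero B Z0)).
Qed.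

End Subcategories.

(** * Shifts and orthogonality *)

Section Shift.
Variable T : tricat.
Implicit Types A B X : T.
Notation shift_iter n A := (iter n (@shift T) A).

Lemma shiftm0 A B : shiftm (0 : hom A B) = 0.
Proof. by apply: (addrI (shiftm 0)); rewrite -shiftmD !addr0. Qed.

Lemma shift_iso n A B : isomorphic A B ->
  isomorphic (shift_iter n A) (shift_iter n B).
Proof.
move=> AB; elim: n => //= n [f [g [gf fg]]].
by exists (shiftm f), (shiftm g); rewrite -!shiftmM gf fg !shiftm1.
Qed.

Lemma shift_zero n A : is_zero A -> is_zero (shift_iter n A).
Proof.
move=> A0; elim: n => //= n /is_zero_id An0.
by apply/is_zero_id; rewrite -shiftm1 An0 shiftm0.
Qed.

Lemma shift_biprod n A B X : is_biprod A B X ->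
  is_biprod (shift_iter n A) (shift_iter n B) (shift_iter n X).
Proof.
move=> ABX; elim: n => //= n [i [j [p [q [pi qj pj qi e]]]]].
exists (shiftm i), (shiftm j), (shiftm p), (shiftm q).
by rewrite -!shiftmM -shiftmD pi qj pj qi e !shiftm1 !shiftm0.
Qed.

Lemma subcategory_hom0r (N : set T) :
  subcategory [set Y : T | forall i A, (1 <= i)%N -> N A -> hom0 A (shift_iter i Y)].
Proof.
split.
- move=> Z Z0 i A _ _ f.
  by have [h _] := shift_zero i Z0; apply: h.
- move=> A B X ABX hA hB i Y i1 NY.
  by apply: (hom0_biprodr (shift_biprod i ABX)); [apply: hA|apply: hB].
- move=> A B AB hA i Y i1 NY.
  by apply: (hom0_isor (shift_iso i AB)); apply: hA.
- move=> A B X ABX hX i Y i1 NY.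
  have [k [_ [p [_ [pk _ _ _ _]]]]] := shift_biprod i ABX.
  by apply: (hom0_retract_r pk); apply: hX.
Qed.

Lemma subcategory_hom0l (N : set T) :
  subcategory [set Y : T | forall i A, (1 <= i)%N -> N A -> hom0 Y (shift_iter i A)].
Proof.
split.
- move=> Z [_ Z0] i A _ _ f; exact: Z0.
- move=> A B X ABX hA hB i Y i1 NY.
  by apply: (hom0_biprodl ABX); [apply: hA|apply: hB].
- move=> A B AB hA i Y i1 NY.
  by apply: (hom0_isol AB); apply: hA.
- move=> A B X [k [_ [p [_ [pk _ _ _ _]]]]] hX i Y i1 NY.
  by apply: (hom0_retract_l pk); apply: hX.
Qed.

End Shift.

(** * Conflations, pushouts and pullbacks in an exact category *)

Section Exact.
Variable C : excat.
Implicit Types A B D X : C.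

Lemma confl_kernel A B D X (f : hom A B) (g : hom B D) (h : hom X B) :
  confl f g -> g ∘ h = 0 -> exists k : hom X A, f ∘ k = h.
Proof.
move=> /(exact_kernel (exactP C))[[_ kerf] _] /kerf[k [kf _]].
by exists k.
Qed.

Lemma confl_mono A B D X (f : hom A B) (g : hom B D) (k k' : hom X A) :
  confl f g -> f ∘ k = f ∘ k' -> k = k'.
Proof.
move=> fg kk'; have [[gf0 kerf] _] := exact_kernel (exactP C) fg.
have [|l [_ uniql]] := kerf _ (f ∘ k); first by rewrite compA gf0 comp0m.
by rewrite -(uniql k) // (uniql k').
Qed.

(** The deflation [g] occurs in some conflation, whose first map is another kernel of [g]. The
    comparison isomorphism of the two kernels carries that conflation to [f], [g]. *)
Lemma kernel_confl A B D (f : hom A B) (g : hom B D) :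
  is_kernel f g -> deflation_of (@confl C) g -> confl f g.
Proof.
move=> [gf0 kerf] [A' [f' fg']].
have [k fk] := confl_kernel fg' gf0.
have [k' [fk' _]] := kerf _ f' (confl_comp0 fg').
have [l [_ uniql]] := kerf _ f gf0.
apply: (exact_iso (exactP C) (a := k') _ (isom_idm B) (isom_idm D) _ _ fg').
- exists k; split; first by apply: (confl_mono fg'); rewrite compA fk fk' compm1.
  rewrite -(uniql (k' ∘ k)); last by rewrite compA fk' fk.
  exact/uniql/compm1.
- by rewrite comp1m fk'.
- by rewrite comp1m compm1.
Qed.

Lemma cokernel_confl A B D (f : hom A B) (g : hom B D) :
  is_cokernel f g -> inflation_of (@confl C) f -> confl f g.
Proof.
move=> [gf0 cokg] [D' [g' fg']].
have [k kg] := confl_coker fg' gf0.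
have [k' [kg' _]] := cokg _ g' (confl_comp0 fg').
have [l [_ uniql]] := cokg _ g gf0.
apply: (exact_iso (exactP C) (d := k) (isom_idm A) (isom_idm B) _ _ _ fg').
- exists k'; split; last first.
    rewrite -(uniql (k ∘ k')); last by rewrite -compA kg' kg.
    exact/uniql/comp1m.
  by apply: (confl_epi fg'); rewrite -compA kg kg' comp1m.
- by rewrite comp1m compm1.
- by rewrite compm1 kg.
Qed.

Lemma pushout_uniq A B A' Q X (f : hom A B) (u : hom A A') (f' : hom A' Q)
    (u' : hom B Q) (h h' : hom Q X) : is_pushout f u f' u' ->
  h ∘ f' = h' ∘ f' -> h ∘ u' = h' ∘ u' -> h = h'.
Proof.
move=> [e univ] hf hu.
have [|l [_ uniql]] := univ _ (h ∘ f') (h ∘ u'); first by rewrite -!compA e.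
by rewrite -(uniql h) // (uniql h').
Qed.

Lemma pullback_uniq Q B' B D X (g' : hom Q B') (v' : hom Q B)
    (v : hom B' D) (g : hom B D) (h h' : hom X Q) : is_pullback g' v' v g ->
  g' ∘ h = g' ∘ h' -> v' ∘ h = v' ∘ h' -> h = h'.
Proof.
move=> [e univ] hf hu.
have [|l [_ uniql]] := univ _ (g' ∘ h) (v' ∘ h); first by rewrite !compA e.
by rewrite -(uniql h) // (uniql h').
Qed.

Lemma pushout_sym A B A' Q (f : hom A B) (u : hom A A') (f' : hom A' Q)
    (u' : hom B Q) : is_pushout f u f' u' -> is_pushout u f u' f'.
Proof.
move=> [e univ]; split=> [|X a b ab]; first by rewrite e.
have [k [[k1 k2] uniqk]] := univ X b a (esym ab); exists k; split=> //.
by move=> k' [k1' k2']; apply: uniqk.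
Qed.

Lemma pullback_sym Q B' B D (g' : hom Q B') (v' : hom Q B)
    (v : hom B' D) (g : hom B D) :
  is_pullback g' v' v g -> is_pullback v' g' g v.
Proof.
move=> [e univ]; split=> [|X a b ab]; first by rewrite e.
have [k [[k1 k2] uniqk]] := univ X b a (esym ab); exists k; split=> //.
by move=> k' [k1' k2']; apply: uniqk.
Qed.

(** The axiom provides one pushout with this property; uniqueness of pushouts transports it to any
    other. *)
Lemma pushout_inflation A B A' Q (f : hom A B) (u : hom A A')
    (f' : hom A' Q) (u' : hom B Q) :
  is_pushout f u f' u' -> inflation_of (@confl C) f ->
  inflation_of (@confl C) f'.
Proof.
move=> po inf; have [Q0 [f0 [u0 [po0 [D [g fg]]]]]] := exact_pushout (exactP C) u inf.
have [k [[kf ku] _]] := (snd po0) _ f' u' (fst po).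
have [k' [[kf' ku'] _]] := (snd po) _ f0 u0 (fst po0).
exists D, (g ∘ k').
apply: (exact_iso (exactP C) (b := k) (isom_idm A') _ (isom_idm D) _ _ fg).
- exists k'; split.
    by apply: (pushout_uniq po0); rewrite -compA ?kf ?ku ?kf' ?ku' comp1m.
  by apply: (pushout_uniq po); rewrite -compA ?kf' ?ku' ?kf ?ku comp1m.
- by rewrite compm1 kf.
- rewrite comp1m -compA -[LHS]compm1; congr (g ∘ _).
  apply/esym; apply: (pushout_uniq po0); rewrite -compA ?kf ?ku ?kf' ?ku' comp1m //.
Qed.

Lemma pullback_deflation Q B' B D (g' : hom Q B') (v' : hom Q B)
    (v : hom B' D) (g : hom B D) :
  is_pullback g' v' v g -> deflation_of (@confl C) g ->
  deflation_of (@confl C) g'.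
Proof.
move=> pb def; have [Q0 [g0 [v0 [pb0 [A [f fg]]]]]] := exact_pullback (exactP C) v def.
have [k [[kg kv] _]] := (snd pb0) _ g' v' (fst pb).
have [k' [[kg' kv'] _]] := (snd pb) _ g0 v0 (fst pb0).
exists A, (k' ∘ f).
apply: (exact_iso (exactP C) (b := k') (isom_idm A) _ (isom_idm B') _ _ fg).
- exists k; split.
    by apply: (pullback_uniq pb0); rewrite compA ?kg ?kv ?kg' ?kv' compm1.
  by apply: (pullback_uniq pb); rewrite compA ?kg ?kv ?kg' ?kv' compm1.
- by rewrite compm1.
- by rewrite comp1m kg'.
Qed.

Lemma pushout_confl A B D A' Q (f : hom A B) (g : hom B D) (u : hom A A')
    (f' : hom A' Q) (u' : hom B Q) (g' : hom Q D) :
  confl f g -> is_pushout f u f' u' -> g' ∘ u' = g -> g' ∘ f' = 0 -> confl f' g'.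
Proof.
move=> fg po gu gf; apply: cokernel_confl; last first.
  by apply: (pushout_inflation po); exists D, g.
split=> // X h hf.
have [|k kg] := confl_coker (h := h ∘ u') fg.
  by rewrite -compA (fst po) compA hf comp0m.
exists k; split=> [|k' kg'].
  by apply: (pushout_uniq po); rewrite -compA ?gu // gf compm0 hf.
by apply: (confl_epi fg); rewrite kg -kg' -compA gu.
Qed.

Lemma pullback_confl Q A B' B D (f : hom A B) (g : hom B D) (v : hom B' D)
    (f' : hom A Q) (g' : hom Q B') (v' : hom Q B) :
  confl f g -> is_pullback g' v' v g -> v' ∘ f' = f -> g' ∘ f' = 0 -> confl f' g'.
Proof.
move=> fg pb vf gf; apply: kernel_confl; last first.
  by apply: (pullback_deflation pb); exists A, f.
split=> // X h gh.
have [|k fk] := confl_kernel (h := v' ∘ h) fg.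
  by rewrite compA (fst pb) -compA gh compm0.
exists k; split=> [|k' fk'].
  by apply: (pullback_uniq pb); rewrite compA ?vf // gf comp0m gh.
by apply: (confl_mono fg); rewrite fk -fk' compA vf.
Qed.

Lemma confl_pushout A B D A' (f : hom A B) (g : hom B D) (u : hom A A') :
  confl f g -> exists Q (f' : hom A' Q) (u' : hom B Q) (g' : hom Q D),
    [/\ is_pushout f u f' u', g' ∘ u' = g, g' ∘ f' = 0 & confl f' g'].
Proof.
move=> fg; have [|Q [f' [u' [po _]]]] := exact_pushout (exactP C) (f := f) u.
  by exists D, g.
have [|g' [[gf gu] _]] := (snd po) D 0 g; first by rewrite comp0m (confl_comp0 fg).
by exists Q, f', u', g'; split=> //; apply: (pushout_confl fg po).
Qed.

Lemma confl_pullback A B' B D (f : hom A B) (g : hom B D) (v : hom B' D) :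
  confl f g -> exists Q (f' : hom A Q) (g' : hom Q B') (v' : hom Q B),
    [/\ is_pullback g' v' v g, v' ∘ f' = f, g' ∘ f' = 0 & confl f' g'].
Proof.
move=> fg; have [|Q [g' [v' [pb _]]]] := exact_pullback (exactP C) v (g := g).
  by exists A, f.
have [|f' [[gf vf] _]] := (snd pb) A 0 f; first by rewrite compm0 (confl_comp0 fg).
by exists Q, f', g', v'; split=> //; apply: (pullback_confl fg pb).
Qed.

Lemma pushout_infl2 A B D B' D' (f : hom A B) (g : hom B D) (f2 : hom A B')
    (g2 : hom B' D') : confl f g -> confl f2 g2 ->
  exists Q (a : hom B' Q) (b : hom Q D) (c : hom B Q) (d : hom Q D'),
    confl a b /\ confl c d.
Proof.
move=> fg fg2; have [Q [a [c [b [po _ _ ab]]]]] := confl_pushout f2 fg.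
have [|d [[da dc] _]] := (snd po) D' g2 0; first by rewrite comp0m (confl_comp0 fg2).
exists Q, a, b, c, d; split=> //; exact: (pushout_confl fg2 (pushout_sym po)).
Qed.

Lemma pullback_defl2 A B D A' B' (f : hom A B) (g : hom B D) (f2 : hom A' B')
    (g2 : hom B' D) : confl f g -> confl f2 g2 ->
  exists Q (a : hom A Q) (b : hom Q B') (c : hom A' Q) (d : hom Q B),
    confl a b /\ confl c d.
Proof.
move=> fg fg2; have [Q [a [b [d [pb _ _ ab]]]]] := confl_pullback g2 fg.
have [|c [[bc dc] _]] := (snd pb) A' f2 0; first by rewrite compm0 (confl_comp0 fg2).
exists Q, a, b, c, d; split=> //; exact: (pullback_confl fg2 (pullback_sym pb)).
Qed.

(** Noether's isomorphism theorem: [K] is the preimage of [A'] in [B], built as the pullback of [g]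
    along [i], and [X] = D/A' = B/K. *)
Lemma confl_noether A B D A' X (f : hom A B) (g : hom B D) (i : hom A' D)
    (p : hom D X) : confl f g -> confl i p ->
  exists K (a : hom A K) (b : hom K A') (c : hom K B),
    confl a b /\ confl c (p ∘ g).
Proof.
move=> fg ip; have [K [a [b [c [pb ca ba ab]]]]] := confl_pullback i fg.
exists K, a, b, c; split=> //; apply: kernel_confl; last first.
  by apply: (exact_defl_comp (exactP C)); [exists A, f|exists A', i].
split; first by rewrite -compA (fst pb) compA (confl_comp0 ip) comp0m.
move=> Y h; rewrite -compA => /(confl_kernel ip)[k ik].
have [l [[bl cl] _]] := (snd pb) _ k h (esym ik).
exists l; split=> // l' cl'; apply: (pullback_uniq pb); last by rewrite cl.
by apply: (confl_mono ip); rewrite !compA -(fst pb) -!compA cl cl'.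
Qed.

Lemma confl_id0 A : exists Z (g : hom A Z), is_zero Z /\ confl (idm A) g.
Proof.
have [Z [g fg]] := exact_infl_id (exactP C) A; exists Z, g; split=> //.
have g0 : g = 0 by rewrite -(compm1 g) (confl_comp0 fg).
by apply/is_zero_id; apply: (confl_epi fg); rewrite comp1m comp0m.
Qed.

Lemma confl_0id A : exists Z (f : hom Z A), is_zero Z /\ confl f (idm A).
Proof.
have [Z [f fg]] := exact_defl_id (exactP C) A; exists Z, f; split=> //.
have g0 : f = 0 by rewrite -(comp1m f) (confl_comp0 fg).
by apply/is_zero_id; apply: (confl_mono fg); rewrite compm1 compm0.
Qed.

(* A biproduct of [A] and [B] is a pushout of [0 -> B] along [0 -> A]. *)
Lemma split_confl A B S (i : hom A S) (j : hom B S) (p : hom S A) (q : hom S B) :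
  p ∘ i = idm A -> q ∘ j = idm B -> p ∘ j = 0 -> q ∘ i = 0 ->
  i ∘ p + j ∘ q = idm S -> confl i q.
Proof.
move=> pi qj pj qi e; have [Z [z [[Z0 Z0'] zB]]] := confl_0id B.
apply: (pushout_confl (u := 0) (u' := j) zB) => //; split.
  by rewrite [LHS]Z0' [RHS]Z0'.
move=> X a b _; exists (a ∘ p + b ∘ q); split.
  by rewrite !compDl -!compA pi pj qi qj !compm0 !compm1 addr0 add0r.
by move=> k [<- <-]; rewrite -!compA -compDr e compm1.
Qed.

Lemma biprod_confl A B S : is_biprod A B S ->
  exists (i : hom A S) (q : hom S B), confl i q.
Proof.
by move=> [i [j [p [q [? ? ? ? ?]]]]]; exists i, q; apply: (split_confl (j := j) (p := p)).
Qed.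

Lemma retraction_section A B D (f : hom A B) (g : hom B D) (r : hom B A) :
  confl f g -> r ∘ f = idm A ->
  exists s, [/\ g ∘ s = idm D, r ∘ s = 0 & f ∘ r + s ∘ g = idm B].
Proof.
move=> fg rf; have [|s sg] := confl_coker (h := idm B - f ∘ r) fg.
  by rewrite compBl -compA rf comp1m compm1 subrr.
exists s; split; last by rewrite sg addrC subrK.
  apply: (confl_epi fg).
  by rewrite -compA sg comp1m compBr compA (confl_comp0 fg) comp0m compm1 subr0.
apply: (confl_epi fg).
by rewrite -compA sg comp0m compBr compA rf comp1m compm1 subrr.
Qed.

Lemma retraction_biprod A B D (f : hom A B) (g : hom B D) (r : hom B A) :
  confl f g -> r ∘ f = idm A -> is_biprod A D B.
Proof.
move=> fg rf; have [s [gs rs e]] := retraction_section fg rf.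
by exists f, s, r, g; split=> //; exact: confl_comp0 fg.
Qed.

Lemma section_biprod A B D (f : hom A B) (g : hom B D) (s : hom D B) :
  confl f g -> g ∘ s = idm D -> is_biprod A D B.
Proof.
move=> fg gs; have [|r fr] := confl_kernel (h := idm B - s ∘ g) fg.
  by rewrite compBr compA gs comp1m compm1 subrr.
apply: (retraction_biprod (r := r) fg); apply: (confl_mono fg).
by rewrite compA fr compBl -compA (confl_comp0 fg) compm0 subr0 comp1m compm1.
Qed.

Lemma Inj_split A B D (f : hom A B) (g : hom B D) :
  confl f g -> Inj C A -> is_biprod A D B.
Proof.
move=> fg iA; have [r rf] := iA _ _ _ _ _ (idm A) fg.
exact: retraction_biprod fg rf.
Qed.

(** The map (f, u) is the split inflation (f, 1) : A -> B ⊕ A, with cokernel (1, -f), followed by 1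
    ⊕ u : B ⊕ A -> B ⊕ I, the pushout of [u] along the inclusion of [A]. *)
Lemma inflation_pair A B I S (f : hom A B) (u : hom A I)
    (iB : hom B S) (iI : hom I S) (pB : hom S B) (pI : hom S I) :
  inflation_of (@confl C) u ->
  pB ∘ iB = idm B -> pI ∘ iI = idm I -> pB ∘ iI = 0 -> pI ∘ iB = 0 ->
  iB ∘ pB + iI ∘ pI = idm S -> inflation_of (@confl C) (iB ∘ f + iI ∘ u).
Proof.
move=> infu pi qj pj qi e.
have [S' [jB [jA [qB [qA [bb aa ba ab e']]]]]] := has_biprod B A.
have -> : iB ∘ f + iI ∘ u = (iB ∘ qB + iI ∘ u ∘ qA) ∘ (jB ∘ f + jA).
  rewrite compDr !compDl -!compA !(compA qB) !(compA qA) bb aa ba ab.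
  by rewrite !comp1m !comp0m !compm0 !compm1 addr0 add0r.
apply: (exact_infl_comp (exactP C)).
  exists B, (qB - f ∘ qA); apply: (split_confl (j := jB) (p := qA)) => //.
  - by rewrite compDr compA ab comp0m add0r.
  - by rewrite compBl -compA ab compm0 subr0.
  - rewrite compBl !compDr -!compA !(compA qB) !(compA qA) bb aa ba ab.
    by rewrite !comp1m !comp0m !compm0 compm1 addr0 add0r subrr.
  - by rewrite compBr compDl -compA addrC addrA subrK e'.
apply: (pushout_inflation (f := u) (u := jA) (u' := iI)) => //; split.
  by rewrite compDl -!compA ba aa !compm0 compm1 add0r.
move=> X a b ab'; exists (a ∘ jB ∘ pB + b ∘ pI); split; first split.
- rewrite compDl !compDr -!compA !(compA pB) !(compA pI) pi qj pj qi.
  rewrite !comp1m !comp0m !compm0 addr0 add0r.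
  by rewrite (compA b) ab' -compA -compDr e' compm1.
- by rewrite compDl -!compA pj qj !compm0 compm1 add0r.
- move=> k [<- <-]; rewrite -(compA k) compDl -!compA bb ab !compm0 compm1 addr0.
  by rewrite -compDr e compm1.
Qed.

End Exact.
(** * Stable categories of Frobenius categories *)

Section StableCategory.
Variable C : frobcat.
Implicit Types A B D I P Q X Y Z : C.
Local Notation T := (stable C).
Local Notation Sh n A := (iter n (@shift T) A).

Definition sm A B (f : hom A B) : @hom T A B := stab f.

Lemma smM A B D (g : hom B D) (f : hom A B) : sm (g ∘ f) = sm g ∘ sm f.
Proof. exact: stab_comp. Qed.

Lemma sm1 A : sm (idm A) = idm (A : T).
Proof. by []. Qed.

Lemma smD A B (f g : hom A B) : sm (f + g) = sm f + sm g.
Proof. exact: stabD. Qed.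

Lemma sm0 A B : sm (0 : hom A B) = 0.
Proof. exact: stab0. Qed.

Lemma sm_surj A B (f : @hom T A B) : exists f0 : hom A B, f = sm f0.
Proof. by exists (repr f); rewrite /sm stabK. Qed.

Lemma sm_eq A B (f g : hom A B) : sm f = sm g <->
  exists P (a : hom A P) (b : hom P B), Proj C P /\ f - g = b ∘ a.
Proof.
split=> [/stab_eq/asboolP // | h]; apply/stab_eq; exact/asboolP.
Qed.

Lemma sm_eq0 A B (f : hom A B) : sm f = 0 <->
  exists P (a : hom A P) (b : hom P B), Proj C P /\ f = b ∘ a.
Proof. by rewrite -(sm0 A B) sm_eq subr0. Qed.

Lemma InjP P : Inj C P <-> Proj C P.
Proof. by rewrite frob_projinj. Qed.

Lemma sm_eq0_defl A B K P (f : hom A B) (i : hom K P) (p : hom P B) :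
  confl i p -> sm f = 0 -> exists g : hom A P, f = p ∘ g.
Proof.
move=> ip /sm_eq0[Q [a [b [pQ ->]]]].
have [c <-] := pQ _ _ _ _ _ b ip.
by exists (c ∘ a); rewrite compA.
Qed.

Lemma sm_eq0_infl A B K P (f : hom A B) (i : hom A P) (p : hom P K) :
  confl i p -> sm f = 0 -> exists g : hom P B, f = g ∘ i.
Proof.
move=> ip /sm_eq0[Q [a [b [/InjP iQ ->]]]].
have [c <-] := iQ _ _ _ _ _ a ip.
by exists (b ∘ c); rewrite compA.
Qed.

Lemma hom0P A B : @hom0 T A B <-> forall f : hom A B, sm f = 0.
Proof.
split=> h f; first exact: h.
by have [f0 ->] := sm_surj f.
Qed.

Lemma stable_zeroP Z : @is_zero T Z <-> Proj C Z.
Proof.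
rewrite (@is_zero_id T) -sm1; split=> [/sm_eq0[P [a [b [pP e]]]]|pZ].
  move=> A B D f g h fg; have [k gk] := pP _ _ _ _ _ (h ∘ b) fg.
  by exists (k ∘ a); rewrite compA gk -compA -e compm1.
by apply/sm_eq0; exists Z, (idm Z), (idm Z); rewrite comp1m.
Qed.

Lemma hom0_projr A P : Proj C P -> @hom0 T A P.
Proof. by move=> /stable_zeroP[h _]; exact: h. Qed.

Lemma hom0_projl A P : Proj C P -> @hom0 T P A.
Proof. by move=> /stable_zeroP[_ h]; exact: h. Qed.

Lemma stable_isomorphic A B : isomorphic A B -> @isomorphic T A B.
Proof.
by move=> [f [g [gf fg]]]; exists (sm f), (sm g); rewrite -!smM gf fg.
Qed.

Lemma stable_biprod A B X : is_biprod A B X -> @is_biprod T A B X.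
Proof.
move=> [i [j [p [q [pi qj pj qi e]]]]]; exists (sm i), (sm j), (sm p), (sm q).
by rewrite -!smM -smD pi qj pj qi e !sm0.
Qed.

Lemma subcategory_unstable (N : set T) : subcategory N -> @subcategory C N.
Proof.
move=> sN; split.
- by move=> Z Z0; apply: (subcat_zero sN); apply/stable_zeroP/Proj_zero.
- by move=> A B X /stable_biprod; apply: (subcat_sum sN).
- by move=> A B /stable_isomorphic; apply: (subcat_iso sN).
- by move=> A B X /stable_biprod; apply: (subcat_summand sN).
Qed.

(* For a stable isomorphism [f], with [u : A -> I] an injective hull, the
   inflation [(f, u) : A -> B ⊕ I] splits and its cokernel is projective. *)
Lemma stable_iso_sum A B : @isomorphic T A B ->
  exists I Q X, [/\ Proj C I, Proj C Q, is_biprod B I X & is_biprod A Q X].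
Proof.
move=> [F [G [GF FG]]]; have [f Ff] := sm_surj F; have [g Gg] := sm_surj G.
rewrite {}Ff {}Gg in GF FG.
have pI : Proj C (hull A) by apply/InjP; apply: ip_inj.
have cu : confl (hull_in A) (hull_out A) := ip_confl (ipres A).
have [X bX] := has_biprod B (hull A).
have [iB [iI [pB [pI' [h1 h2 h3 h4 h5]]]]] := bX.
have [|Q [q fq]] := inflation_pair f (u := hull_in A) _ h1 h2 h3 h4 h5.
  by exists (cosyz A), (hull_out A).
rewrite -!smM -!sm1 in GF FG.
have /(sm_eq0_infl cu)[c ec] : sm (idm A - g ∘ f) = 0.
  by apply/sm_eq0/sm_eq; rewrite GF.
have rf : (g ∘ pB + c ∘ pI') ∘ (iB ∘ f + iI ∘ hull_in A) = idm A.
  rewrite compDl !compDr -!compA !(compA pB) !(compA pI') h1 h2 h3 h4.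
  by rewrite !comp1m !comp0m !compm0 addr0 add0r -ec addrC subrK.
have [s [qs _ _]] := retraction_section fq rf.
exists (hull A), Q, X; split=> //; last exact: retraction_biprod fq rf.
(* As [s] is a section of [q], it suffices that [q] is stably zero. On [I] it starts from a
   projective; on [B] it vanishes after composition with the stable isomorphism [f], since [q] kills
   (f, u). *)
apply/stable_zeroP/is_zero_id; rewrite -sm1.
have qf : sm (q ∘ iB ∘ f) = 0.
  have := confl_comp0 fq; rewrite compDr => /(congr1 (@sm _ _)).
  rewrite smD (compA q iI) (smM _ (hull_in A)) (hom0_projr pI (sm (hull_in A))).
  by rewrite compm0 addr0 sm0 compA.
have qiB : sm (q ∘ iB) = 0.
  by rewrite -(compm1 (sm (q ∘ iB))) -sm1 -FG -smM compA smM qf comp0m.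
rewrite -qs -(comp1m s) -h5 compDl compDr -!compA (compA q) smD smM qiB comp0m.
by rewrite add0r !smM (hom0_projr pI (_ ∘ sm s)) !compm0.
Qed.

(** By [stable_iso_sum], stably isomorphic objects become isomorphic after adding projectives, which
    [N] contains. So [N] is closed under stable isomorphism, and a stable biproduct may be replaced
    by one in [C]. *)
Lemma subcategory_stable (N : set C) :
  subcategory N -> Proj C `<=` N -> @subcategory T N.
Proof.
move=> sN pN.
have iso A B : @isomorphic T A B -> N A -> N B.
  move=> /stable_iso_sum[I [Q [X [pI pQ BX AX]]]] NA.
  by apply: (subcat_summand sN BX); apply: (subcat_sum sN AX) => //; apply: pN.
split=> //.
- by move=> Z /stable_zeroP/pN.
- move=> A B X AB NA NB; have [S ABS] := has_biprod (A : C) B.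
  apply: (iso S); first exact: biprod_uniq (stable_biprod ABS) AB.
  exact: subcat_sum ABS NA NB.
- move=> A B X AB NX; have [S ABS] := has_biprod (A : C) B.
  apply: (subcat_summand sN ABS); apply: iso NX.
  exact: biprod_uniq AB (stable_biprod ABS).
Qed.

(** * Dimension shifting, and Ext as stable Hom *)

Lemma confl_hull X : confl (hull_in X) (hull_out X).
Proof. exact: ip_confl. Qed.

Lemma Proj_hull X : Proj C (hull X).
Proof. by apply/InjP; apply: ip_inj. Qed.

Lemma confl_syz X : confl (pp_incl (pres X)) (pp_map (pres X)).
Proof. exact: pp_confl. Qed.

Lemma Proj_cover X : Proj C (cover X).
Proof. exact: pp_proj. Qed.

(** Each map of the ends extends to a map of conflations, as the middle terms are projective and
    injective. If the map at the other end is stably zero, correcting the middle map makes the given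
    one factor through [I] or [P]. *)
Lemma hom0_cosyzygy A P B X I Y (i : hom A P) (g : hom P B) (j : hom X I)
    (q : hom I Y) : confl i g -> confl j q -> Proj C P -> Proj C I ->
  @hom0 T A X <-> @hom0 T B Y.
Proof.
move=> ig jq pP pI; split=> /hom0P h0; apply/hom0P => f.
  have [h qh] := pP _ _ _ _ _ (f ∘ g) jq.
  have [|k jk] := confl_kernel (h := h ∘ i) jq.
    by rewrite compA qh -compA (confl_comp0 ig) compm0.
  have [l kl] := sm_eq0_infl ig (h0 k).
  have [|s sg] := confl_coker (h := h - j ∘ l) ig.
    by rewrite compBl -compA -kl jk subrr.
  apply/sm_eq0; exists I, s, q; split=> //; apply: (confl_epi ig).
  by rewrite -compA sg compBr compA (confl_comp0 jq) comp0m subr0 qh.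
have [h hi] := (proj2 (InjP I) pI) _ _ _ _ _ (j ∘ f) ig.
have [|d dg] := confl_coker (h := q ∘ h) ig.
  by rewrite -compA hi compA (confl_comp0 jq) comp0m.
have [e de] := sm_eq0_defl jq (h0 d).
have [|r jr] := confl_kernel (h := h - e ∘ g) jq.
  by rewrite compBr compA -de dg subrr.
apply/sm_eq0; exists P, i, r; split=> //; apply: (confl_mono jq).
by rewrite compA jr compBl -compA (confl_comp0 ig) compm0 subr0 hi.
Qed.

Lemma hom0_shift A B n : @hom0 T (Sh n A) (Sh n B) <-> @hom0 T A B.
Proof.
elim: n => //= n IHn; rewrite -IHn; apply: iff_sym.
exact: (hom0_cosyzygy (confl_hull (Sh n A)) (confl_hull (Sh n B)) (@Proj_hull _) (@Proj_hull _)).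
Qed.

Lemma hom0_syz A B n : @hom0 T (iter n (@syz C) A) B <-> @hom0 T A (Sh n B).
Proof.
elim: n B => //= n IHn B; rewrite -[cosyz _]/(iter n.+1 (@cosyz C) B) iterSr -IHn.
have := confl_syz (iter n (@syz C) A); move/hom0_cosyzygy; apply.
- exact: confl_hull.
- exact: Proj_cover.
- exact: Proj_hull.
Qed.

Lemma Ext_zero_coboundary n X Y :
  Ext_zero n X Y <-> forall c : cocycle n X Y, is_coboundary (c : hom _ _).
Proof.
have pi0 (c : cocycle n X Y) :
    (\pi c : Ext n X Y)%qT = 0 <-> is_coboundary (c : hom _ _).
  rewrite -[0](raddf0 (\pi_(Ext n X Y)%qT)) -{2}(subr0 c).
  split=> [/eqP|h]; first by rewrite -Quotient.idealrBE => /asboolP.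
  by apply/eqP; rewrite -Quotient.idealrBE; apply/asboolP.
split=> [h c|h e]; first exact/pi0/h.
by rewrite -(reprK e); apply/pi0/h.
Qed.

(** An n-cocycle is a map from the n-th syzygy of [X] to [Y]. It is a coboundary exactly when it
    extends along the inclusion of that syzygy into a projective, that is, when it is stably
    zero. *)
Lemma Ext_zeroP n X Y : (1 <= n)%N -> Ext_zero n X Y <-> @hom0 T X (Sh n Y).
Proof.
case: n => // n _; rewrite -hom0_syz hom0P Ext_zero_coboundary.
have ci := confl_syz (iter n (@syz C) X).
have cp := confl_syz (iter n.+1 (@syz C) X).
split=> h => [f|[f fc]].
  have f0 : f ∘ pp_map (pres (iter n.+1 (@syz C) X)) \in @is_cocycle C n.+1 X Y.
    by apply/eqP; rewrite -compA compA -(compA f) (compA (pp_map _)) (confl_comp0 cp) comp0m compm0.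
  have /= [g] := h (Cocycle f0); rewrite /resol_diff compA.
  move=> /(confl_epi cp) ->; apply/sm_eq0.
  exists (cover (iter n (@syz C) X)), (pp_incl (pres (iter n (@syz C) X))), g.
  by split; first exact: Proj_cover.
have := eqP fc; rewrite /resol_diff compA => f0.
have [|k kf] := confl_coker (h := f) cp.
  by apply: (confl_epi (confl_syz (iter n.+2 (@syz C) X))); rewrite comp0m.
have [g kg] := sm_eq0_infl ci (h k).
by exists g; rewrite /= -kf /resol_diff compA -kg.
Qed.


(** * Conflations and triangles *)

Lemma stable_distinguished_confl A B D (u : hom A B) (v : hom B D)
    (w : hom D (cosyz A)) :
  standard_triangle u v w -> @distinguished T A B D (sm u) (sm v) (sm w).
Proof.
move=> uvw; exists A, B, D, u, v, w, (idm (A : T)), (idm (B : T)), (idm (D : T)).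
split=> //; first by split; apply: isom_idm.
split; rewrite ?comp1m ?compm1 //.
by rewrite [X in X ∘ _](@shiftm1 T) comp1m.
Qed.

Lemma standard_triangle_confl A B D (u : hom A B) (v : hom B D)
    (w : hom D (cosyz A)) : standard_triangle u v w -> confl v w.
Proof.
by move=> [u' [po wu wv]]; apply: pushout_confl (confl_hull A) po wu wv.
Qed.

(** The pushout [Q] of [f] and the hull of [A] is also an extension of [D] by that hull. This
    extension splits, and the hull is stably zero. *)
Lemma confl_standard A B D (f : hom A B) (g : hom B D) : confl f g ->
  exists Q (v : hom B Q) (w : hom Q (cosyz A)),
    standard_triangle f v w /\ @isomorphic T Q D.
Proof.
move=> fg; have [Q [v [u' [w [po wu wv _]]]]] := confl_pushout f (confl_hull A).
exists Q, v, w; split; first by exists u'.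
have [d [du dv]] : exists d : hom Q D, d ∘ v = g /\ d ∘ u' = 0.
  have [|d [[dv du] _]] := (snd po) D g 0; last by exists d.
  by rewrite comp0m (confl_comp0 fg).
have ud := pushout_confl fg (pushout_sym po) du dv.
have /stable_biprod : is_biprod (hull A) D Q.
  by apply: Inj_split ud _; apply/InjP/Proj_hull.
by apply: biprod_zerol; apply/stable_zeroP/Proj_hull.
Qed.

(* Distinguished triangles A -> B -> D -> A[1], with the morphisms forgotten. *)
Definition triangle A B D : Prop :=
  exists A' B' D' (f : hom A' B') (g : hom B' D'), confl f g /\
    [/\ @isomorphic T A' A, @isomorphic T B' B & @isomorphic T D' D].

Lemma confl_triangle A B D (f : hom A B) (g : hom B D) : confl f g -> triangle A B D.
Proof. by move=> fg; exists A, B, D, f, g; split=> //; split; apply: isomorphic_refl. Qed.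

Lemma triangle_rotate A B D : triangle A B D -> triangle B D (cosyz A).
Proof.
move=> [A' [B' [D' [f [g [fg [AA BB DD]]]]]]].
have [Q [v [w [/standard_triangle_confl vw QD]]]] := confl_standard fg.
exists B', Q, (cosyz A'), v, w; split=> //; split=> //.
  exact: isomorphic_trans QD DD.
exact: (@shift_iso T 1) AA.
Qed.

(** Three rotations amount to one shift. *)
Lemma triangle_shift n A B D : triangle A B D -> triangle (Sh n A) (Sh n B) (Sh n D).
Proof. by move=> ABD; elim: n => //= n IHn; do 3! apply: triangle_rotate. Qed.

(** The conclusion is rotated because the conflation inside a standard triangle is B -> D -> A[1];
    the map [u] is arbitrary. *)
Lemma distinguished_triangle A B D (u : @hom T A B) (v : @hom T B D)
  (w : @hom T D (@shift T A)) : distinguished u v w -> triangle B D (@shift T A).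
Proof.
move=> [A' [B' [D' [u' [v' [w' [a [b [d [st [ia ib id] _]]]]]]]]]].
exists B', D', (cosyz A'), v', w'; split; first exact: standard_triangle_confl st.
split; apply: isomorphic_sym; [by exists b|by exists d|].
by apply: (@shift_iso T 1); exists a.
Qed.

Lemma hom0_trianglel A B D X : triangle A B D ->
  @hom0 T A X -> @hom0 T D X -> @hom0 T B X.
Proof.
move=> [A' [B' [D' [f [g [fg [AA BB DD]]]]]]] hA hD; apply: hom0_isol BB _.
have /hom0P{}hA := hom0_isol (isomorphic_sym AA) hA.
have /hom0P{}hD := hom0_isol (isomorphic_sym DD) hD.
apply/hom0P => k; have /sm_eq0[P [a [b [pP e]]]] := hA (k ∘ f).
have [c cE] := (proj2 (InjP P) pP) _ _ _ _ _ a fg.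
have [|l lg] := confl_coker (h := k - b ∘ c) fg.
  by rewrite compBl -compA cE e subrr.
have -> : k = b ∘ c + l ∘ g by rewrite lg addrC subrK.
by rewrite smD !smM (hom0_projl pP (sm b)) (hD l) !comp0m addr0.
Qed.

Lemma hom0_triangler A B D X : triangle A B D ->
  @hom0 T X A -> @hom0 T X D -> @hom0 T X B.
Proof.
move=> [A' [B' [D' [f [g [fg [AA BB DD]]]]]]] hA hD; apply: hom0_isor BB _.
have /hom0P{}hA := hom0_isor (isomorphic_sym AA) hA.
have /hom0P{}hD := hom0_isor (isomorphic_sym DD) hD.
apply/hom0P => k; have /sm_eq0[P [a [b [pP e]]]] := hD (g ∘ k).
have [c cE] := pP _ _ _ _ _ b fg.
have [|l fl] := confl_kernel (h := k - c ∘ a) fg.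
  by rewrite compBr compA cE e subrr.
have -> : k = c ∘ a + f ∘ l by rewrite fl addrC subrK.
by rewrite smD !smM (hom0_projr pP (sm a)) (hA l) !compm0 addr0.
Qed.

(** The conflation is classified by a map [d] : D -> A[1]. If [d] is stably zero it lifts to the
    hull of [A], and subtracting the lift from the extension [k] of [hull_in A] yields a retraction
    of [f]. *)
Lemma hom0_split A B D (f : hom A B) (g : hom B D) :
  confl f g -> @hom0 T D (cosyz A) -> is_biprod A D B.
Proof.
move=> fg /hom0P h; have ch := confl_hull A.
have [k kf] := (proj2 (InjP _) (@Proj_hull A)) _ _ _ _ _ (hull_in A) fg.
have [|d dg] := confl_coker (h := hull_out A ∘ k) fg.
  by rewrite -compA kf (confl_comp0 ch).
have [e de] := sm_eq0_defl ch (h d).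
have [|r jr] := confl_kernel (h := k - e ∘ g) ch.
  by rewrite compBr compA -de dg subrr.
apply: (retraction_biprod (r := r) fg); apply: (confl_mono ch).
by rewrite compA jr compBl -compA (confl_comp0 fg) compm0 subr0 kf compm1.
Qed.

Lemma hom0_shiftl A B n m : (n <= m)%N ->
  @hom0 T (Sh n A) (Sh m B) <-> @hom0 T A (Sh (m - n) B).
Proof. by move=> nm; rewrite -{1}(subnKC nm) iterD hom0_shift. Qed.

Lemma thick_confl (N : set T) A B D (f : hom A B) (g : hom B D) :
  thick N -> confl f g -> N A -> N B -> N D.
Proof.
move=> tN /confl_standard[Q [v [w [/stable_distinguished_confl st QD]]]] NA NB.
exact: subcat_iso (thick_subcat tN) _ _ QD (thick_cone tN st NA NB).
Qed.

(** The conflation B -> Q -> A[1], with [Q] stably isomorphic to [D], puts A[1] in [N]. *)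
Lemma thick_confl_fib (N : set T) A B D (f : hom A B) (g : hom B D) :
  thick N -> confl f g -> N B -> N D -> N A.
Proof.
move=> tN fg NB ND; have [Q [v [w [/standard_triangle_confl vw QD]]]] := confl_standard fg.
apply: (thick_unshift tN); apply: (thick_confl tN vw NB).
exact: subcat_iso (thick_subcat tN) _ _ (isomorphic_sym QD) ND.
Qed.

(** * Perpendicular classes in terms of stable Hom *)

Lemma rperpP (N : set C) Y : rperp N Y <->
  forall i A, (1 <= i)%N -> N A -> @hom0 T A (Sh i Y).
Proof. by split=> h i A i1 NA; apply/(Ext_zeroP _ _ i1)/h. Qed.

Lemma lperpP (N : set C) Y : lperp N Y <->
  forall i A, (1 <= i)%N -> N A -> @hom0 T Y (Sh i A).
Proof. by split=> h i A i1 NA; apply/(Ext_zeroP _ _ i1)/h. Qed.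

Lemma subcategory_rperp (N : set C) : @subcategory T (rperp N).
Proof.
rewrite (_ : rperp N = [set Y | forall i A, (1 <= i)%N -> N A -> @hom0 T A (Sh i Y)]).
  exact: subcategory_hom0r.
by apply/seteqP; split=> Y /rperpP.
Qed.

Lemma subcategory_lperp (N : set C) : @subcategory T (lperp N).
Proof.
rewrite (_ : lperp N = [set Y | forall i A, (1 <= i)%N -> N A -> @hom0 T Y (Sh i A)]).
  exact: subcategory_hom0l.
by apply/seteqP; split=> Y /lperpP.
Qed.

Lemma Proj_lperp (N : set C) : Proj C `<=` lperp N.
Proof. by move=> P pP; apply/lperpP => i A _ _; apply: hom0_projl. Qed.

Lemma rperp_triangle (N : set C) A B D :
  triangle A B D -> rperp N A -> rperp N D -> rperp N B.
Proof.
move=> ABD /rperpP hA /rperpP hD; apply/rperpP => i X i1 NX.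
by apply: (hom0_triangler (triangle_shift i ABD)); [apply: hA|apply: hD].
Qed.

Lemma lperp_triangle (N : set C) A B D :
  triangle A B D -> lperp N A -> lperp N D -> lperp N B.
Proof.
move=> ABD /lperpP hA /lperpP hD; apply/lperpP => i X i1 NX.
by apply: (hom0_trianglel ABD); [apply: hA|apply: hD].
Qed.

Lemma rperp_shift (N : set C) j A : rperp N A -> rperp N (Sh j A).
Proof.
move=> /rperpP h; apply/rperpP => i X i1 NX.
by rewrite -iterD; apply: h => //; apply: leq_trans i1 (leq_addr _ _).
Qed.

(** In the triangle D -> A[1] -> B[1], maps from the outer terms to X[i+1] vanish. *)
Lemma lperp_fib (N : set C) A B D :
  triangle A B D -> lperp N B -> lperp N D -> lperp N A.
Proof.
move=> ABD /lperpP hB /lperpP hD; apply/lperpP => i X i1 NX.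
apply/(hom0_shift _ _ 1); rewrite -iterD add1n.
apply: (hom0_trianglel (triangle_rotate (triangle_rotate ABD))); first exact: hD.
by apply/(hom0_shift B _ 1)/hB.
Qed.

(** * Categories generated by a presilting subcategory *)

Section Presilting.
Variable M : set C.

(** Extensions and summands are those of [C]; [subcategory_gen] and [gen_triangle] transfer the
    closure properties to the stable category. *)
Inductive gen : C -> Prop :=
| gen_iter j A : M A -> gen (Sh j A)
| gen_ext A B D (f : hom A B) (g : hom B D) : confl f g -> gen A -> gen D -> gen B
| gen_summand A B X : is_biprod A B X -> gen X -> gen A.

Hypothesis subM : subcategory M.
Hypothesis projM : Proj C `<=` M.
Hypothesis rigidM : M `<=` rperp M.

Lemma gen_base A : M A -> gen A.
Proof. exact: (@gen_iter 0). Qed.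

Lemma subcategory_gen : @subcategory T gen.
Proof.
apply: subcategory_stable; last by move=> P /projM; apply: gen_base.
apply: subcategory_summand; last exact: gen_summand.
  by move=> Z /Proj_zero/projM; apply: gen_base.
by move=> A B X /biprod_confl[f [g fg]]; apply: gen_ext fg.
Qed.

Lemma gen_triangle A B D : triangle A B D -> gen A -> gen D -> gen B.
Proof.
move=> [A' [B' [D' [f [g [fg [AA BB DD]]]]]]] gA gD.
apply: (subcat_iso subcategory_gen BB); apply: gen_ext fg _ _.
  exact: subcat_iso subcategory_gen _ _ (isomorphic_sym AA) gA.
exact: subcat_iso subcategory_gen _ _ (isomorphic_sym DD) gD.
Qed.

Lemma gen_shift j A : gen A -> gen (Sh j A).
Proof.
elim=> {A} [i A MA|A B D f g fg _ IHA _ IHD|A B X ABX _ IHX].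
- by rewrite -iterD; apply: gen_iter.
- exact: gen_triangle (triangle_shift j (confl_triangle fg)) IHA IHD.
- exact: subcat_summand subcategory_gen _ _ _ (shift_biprod j (stable_biprod ABX)) IHX.
Qed.

Lemma gen_rperp : gen `<=` rperp M.
Proof.
move=> A; elim=> {A} [i A MA|A B D f g fg _ IHA _ IHD|A B X ABX _ IHX].
- exact/rperp_shift/rigidM.
- exact: rperp_triangle (confl_triangle fg) IHA IHD.
- exact: subcat_summand (subcategory_rperp M) _ _ _ (stable_biprod ABX) IHX.
Qed.

(* Hom(M, gen[i]) = 0 for [i > 0] makes a horseshoe argument possible in the
   case of an extension. *)
Lemma gen_cover X : gen X -> exists X1 Y (f : hom X1 Y) (g : hom Y X),
  [/\ confl f g, M Y & gen X1].
Proof.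
elim=> {X} [[|j] A MA|A X B f g fg gA [A1 [Y [a [b [ab MY gA1]]]]] _
    [B1 [W [c [d [cd MW gB1]]]]]|X X' Z /biprod_sym ZX gZ
    [Z1 [Y [f [g [fg MY gZ1]]]]]].
- have [Z [f [Z0 fid]]] := confl_0id A; exists Z, A, f, (idm A); split=> //.
  exact/gen_base/projM/Proj_zero.
(* A positive shift is the cokernel of a hull, which is projective and so in [M]. *)
- exists (Sh j A), (hull (Sh j A)), (hull_in (Sh j A)), (hull_out (Sh j A)).
  split; [exact: confl_hull|exact/projM/Proj_hull|exact: gen_iter].
(* The pullback [V] of W -> B <- X is an extension of [W] by [A], split since Hom(W, A[1]) = 0.
   Pulling Y -> A back along the projection V -> A gives [U], an extension of [Y] by [W] that splits
   too. The kernel of U -> V -> X is an extension of [B1] by [A1]. *)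
- have [V [i [p [k [q [ip kq]]]]]] := pullback_defl2 fg cd.
  have AW : is_biprod W A V.
    apply/biprod_sym/(hom0_split ip).
    exact: (proj1 (rperpP M A) (gen_rperp gA) 1%N).
  have [s [t st]] := biprod_confl AW.
  have [U [a' [b' [u [v [ab' uv]]]]]] := pullback_defl2 ab st.
  have MU : M U.
    apply: (subcat_sum subM _ MW MY); apply: (hom0_split uv).
    exact: (proj1 (rperpP M W) (rigidM MW) 1%N).
  have [K [l [m [n [lm nq]]]]] := confl_noether ab' kq.
  exists K, U, n, (q ∘ b'); split=> //; exact: gen_ext lm gA1 gB1.
(* The kernel of Y -> Z -> X is an extension of the complement [X'] by [Z1]. *)
- have [i [p ip]] := biprod_confl ZX.
  have [K [l [m [n [lm nq]]]]] := confl_noether fg ip.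
  exists K, Y, n, (p ∘ g); split=> //; apply: gen_ext lm gZ1 _.
  exact: gen_summand ZX gZ.
Qed.

(** Induction on [n]: a special sequence for X[1] is converted into one for [X]. *)
Lemma gen_envelope n X : gen (Sh n X) -> exists Y K (f : hom X Y) (g : hom Y K),
  [/\ confl f g, gen Y & lperp (rperp M) K].
Proof.
elim: n X => [|n IHn] X gX.
  have [Z [g [Z0 idg]]] := confl_id0 X; exists X, Z, (idm X), g; split=> //.
  exact/Proj_lperp/Proj_zero.
rewrite iterSr in gX; have [Y [K [f [g [fg gY lK]]]]] := IHn _ gX.
have [Y1 [W [a [b [ab MW gY1]]]]] := gen_cover gY.
(* [Q] is the preimage of X[1] in [W], that is, the kernel of W -> Y -> K, so it is left orthogonal
   like [W] and [K]. Pulling Q -> X[1] back along the hull of [X] gives [R], an extension of that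
   hull by [Y1], hence in [gen]. *)
have [Q [c [d [e [cd eg]]]]] := confl_noether ab fg.
have [R [i [p [k [q [ip kq]]]]]] := pullback_defl2 (confl_hull X) cd.
exists R, Q, i, p; split=> //.
  by apply: gen_ext kq gY1 _; apply/gen_base/projM/Proj_hull.
apply: (lperp_fib (confl_triangle eg)) lK.
by apply/lperpP => j Z j1 /rperpP; apply.
Qed.

Lemma rperp_gen X n : gen (Sh n X) -> rperp M X -> gen X.
Proof.
move=> /gen_envelope[Y [K [f [g [fg gY /lperpP lK]]]]] rX.
have XK : is_biprod X K Y by apply: (hom0_split fg); apply: (lK 1%N).
exact: gen_summand XK gY.
Qed.

(** The conflation X1 -> Y -> X of [gen_cover] splits, since [X1] lies in [rperp M]; so [X] is a
    summand of [Y]. *)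
Lemma gen_lperp : gen `&` lperp (rperp M) `<=` M.
Proof.
move=> X [/gen_cover[X1 [Y [f [g [fg MY /gen_rperp rX1]]]]] /lperpP lX].
have /biprod_sym XX1 : is_biprod X1 X Y by apply: (hom0_split fg); apply: (lX 1%N).
exact: subcat_summand subM _ _ _ XX1 MY.
Qed.

(** Exponents may be raised by [up], so two objects can share one, and the cone of A -> B is an
    extension of A[1] by [B]. *)
Lemma thick_gen : thick [set X : T | exists n, gen (Sh n X)].
Proof.
have up m n X : gen (Sh n X) -> gen (Sh (m + n) X) by rewrite iterD; apply: gen_shift.
split; first split.
- by move=> Z /stable_zeroP/projM/gen_base gZ; exists 0%N.
- move=> A B X ABX [m gA] [n gB]; exists (n + m)%N.
  apply: (subcat_sum subcategory_gen (shift_biprod _ ABX)); first exact: up.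
  by rewrite addnC; apply: up.
- move=> A B AB [n gA]; exists n.
  exact: subcat_iso subcategory_gen _ _ (shift_iso n AB) gA.
- move=> A B X ABX [n gX]; exists n.
  exact: subcat_summand subcategory_gen _ _ _ (shift_biprod n ABX) gX.
- by move=> A [n gA]; exists n; rewrite -iterSr; apply: (up 1%N).
- by move=> A [n gA]; exists n.+1; rewrite iterSr.
- move=> A B D u v w /distinguished_triangle BDA [m gA] [n gB]; exists (n + m)%N.
  apply: (gen_triangle (triangle_shift _ BDA)); first by rewrite addnC; apply: up.
  by rewrite -iterSr; apply: (up n.+1).
Qed.

(** For [m] in [M], Hom(m[j], B[i]) = Hom(m, B[i-j]) vanishes once i > j; extensions and summands
    keep a finite bound. *)
Lemma gen_bounded A : gen A -> exists t, forall i B, (t <= i)%N -> rperp M B ->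
  @hom0 T A (Sh i B).
Proof.
elim=> {A} [j A MA|A B D f g fg _ [s hs] _ [t ht]|A B X ABX _ [t ht]].
- exists j.+1 => i B ij /rperpP rB.
  by apply/hom0_shiftl; [exact: ltnW|apply: rB; rewrite ?subn_gt0].
- exists (s + t)%N => i X sti rX; apply: (hom0_trianglel (confl_triangle fg)).
    by apply: hs => //; apply: leq_trans sti; apply: leq_addr.
  by apply: ht => //; apply: leq_trans sti; apply: leq_addl.
- exists t => i Y ti rY; have [k [_ [p [_ [pk _ _ _ _]]]]] := stable_biprod ABX.
  by apply: (hom0_retract_l pk); apply: ht.
Qed.

End Presilting.

(** * The two assignments *)

Section SiltingToCoresolving.
Variable M : set C.
Hypothesis subM : subcategory M.
Hypothesis projM : Proj C `<=` M.
Hypothesis siltM : silting (underline M).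

Lemma silting_rigid : M `<=` rperp M.
Proof. by move=> A MA; apply/rperpP => i B i1 MB f; apply: (silting_hom0 siltM i1 MB MA). Qed.

Lemma silting_shift_gen X : exists n, gen M (Sh n X).
Proof.
have : [set: T] X by [].
rewrite -(silting_gen siltM) => /(_ [set Y : T | exists n, gen M (Sh n Y)]); apply.
by split=> [|A MA]; [exact: thick_gen|exists 0%N; apply: gen_base].
Qed.

Lemma silting_rperp : rperp M = gen M.
Proof.
apply/seteqP; split=> X; last exact: (gen_rperp silting_rigid).
by have [n gX] := silting_shift_gen X; exact: (rperp_gen subM projM silting_rigid gX).
Qed.

Lemma silting_coresolving : coresolving_class (rperp M).
Proof.
split.
- exact/subcategory_unstable/subcategory_rperp.
- move=> X; have [n /(gen_envelope subM projM silting_rigid)] := silting_shift_gen X.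
  move=> [Y [K [f [g [fg gY lK]]]]]; exists Y, K, f, g; split=> //.
    by rewrite silting_rperp.
  by move=> Z rZ; apply: lK.
- split.
  + by move=> I /InjP pI; apply: silting_rigid; apply: projM.
  + by move=> A B D f g /confl_triangle ABD rA rD; exact: (rperp_triangle ABD rA rD).
  + move=> A B D f g /confl_triangle/triangle_rotate ABD rA rB.
    exact: (rperp_triangle ABD rB (rperp_shift (j := 1) rA)).
- apply/seteqP; split=> // X _; have [n gX] := silting_shift_gen X.
  (* The coresolution splices the conflations X[i] -> hull -> X[i+1] and stops at X[n], which lies
     in [gen M]. *)
  exists n, (fun i => Sh i X), (fun i => if (i < n)%N then hull (Sh i X) else Sh n X).
  split; [exact: isomorphic_refl|by rewrite ltnn| |] => i.
    case: ifP => _ _; last by rewrite silting_rperp.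
    exact/silting_rigid/projM/Proj_hull.
  by move=> ->; exists (hull_in (Sh i X)), (hull_out (Sh i X)); apply: confl_hull.
- move=> A; rewrite silting_rperp => /(gen_bounded)[t tP]; exists t.+1 => // i B ti.
  rewrite -silting_rperp => rB; apply/Ext_zeroP; first exact: leq_ltn_trans ti.
  by apply: tP => //; apply: ltnW.
Qed.

Lemma silting_recover : rperp M `&` lperp (rperp M) = M.
Proof.
rewrite {1}silting_rperp; apply/seteqP; split.
  exact: gen_lperp subM projM silting_rigid.
move=> A MA; split; first exact: gen_base.
by apply/lperpP => i Z i1 /rperpP; apply.
Qed.

End SiltingToCoresolving.

(** * From coresolving to silting subcategories *)

Section CoresolvingToSilting.
Variable H : set C.
Hypothesis subH : subcategory H.
Hypothesis envH : specially_covariantly_finite H.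
Hypothesis coresH : coresolving H.
Hypothesis checkH : check H = setT.
Hypothesis boundH : forall A, H A -> exists2 t : nat, (1 <= t)%N &
  forall i B, (t <= i)%N -> H B -> Ext_zero i A B.
Local Notation M := (H `&` lperp H).

Lemma coresolving_Proj : Proj C `<=` H.
Proof. by move=> P /InjP; apply: cores_inj. Qed.

Lemma coresolving_shift n A : H A -> H (Sh n A).
Proof.
move=> HA; elim: n => //= n IHn; apply: cores_cone (confl_hull _) IHn _ => //.
exact/coresolving_Proj/Proj_hull.
Qed.

(** Ext^{i+1}(A, B) = Ext^1(A, B[i]), and [H] is closed under shifts. *)
Lemma coresolving_lperp A : (forall B, H B -> Ext_zero 1 A B) -> lperp H A.
Proof.
move=> h; apply/lperpP => -[//|i] B _ HB; rewrite iterS.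
by apply/(@Ext_zeroP 1) => //; apply/h/coresolving_shift.
Qed.

(* [X] arises from a special preenvelope [Ω A -> Y -> K] by pushing out along
   the projective cover of [A], so it is also an extension of [K] by a
   projective. *)
Lemma coresolving_cover A : H A -> exists Y X (f : hom Y X) (g : hom X A),
  [/\ confl f g, H Y & M X].
Proof.
move=> HA; have [Y [K [f [g [fg HY K1]]]]] := envH (syz A).
have [X [a [b [c [d [ab cd]]]]]] := pushout_infl2 (confl_syz A) fg.
exists Y, X, a, b; split=> //; split; first exact: cores_ext ab HY HA.
apply: (lperp_triangle (confl_triangle cd)); last exact: coresolving_lperp.
exact/Proj_lperp/Proj_cover.
Qed.

Lemma coresolving_subcat : subcategory M.
Proof.
by apply: subcategory_setI => //; apply/subcategory_unstable/subcategory_lperp.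
Qed.

Lemma coresolving_projM : Proj C `<=` M.
Proof. by move=> P pP; split; [apply: coresolving_Proj|apply: Proj_lperp]. Qed.

Lemma coresolving_thick_sub (N : set T) : thick N -> M `<=` N -> H `<=` N.
Proof.
move=> tN MN A HA.
have [[//|t] _ tA] := boundH HA.
(* The bound is [t.+1]; at [t] = 0 every positive Ext from [A] to [H] vanishes, so [A] is already in
   [M]. *)
elim: t A HA tA => [|t IHt] A HA tA; first by apply: MN; split=> // i B; apply: tA.
have [Y [X [f [g [fg HY [HX lX]]]]]] := coresolving_cover HA.
(* Ext^i(Y, B) lies between Ext^i(X, B) = 0 and Ext^{i+1}(A, B), so the bound for [Y] is one
   less. *)
apply: (thick_confl tN fg _ (MN _ (conj HX lX))); apply: IHt => // i B ti HB.
have i1 : (0 < i)%N by apply: leq_trans ti.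
apply/(Ext_zeroP _ _ i1)/(hom0_shift _ _ 1); rewrite -iterD add1n.
apply: (hom0_trianglel (triangle_rotate (triangle_rotate (confl_triangle fg)))).
  by apply/(@Ext_zeroP i.+1) => //; apply: tA.
by apply/(hom0_shift X _ 1); move/lperpP: lX; apply.
Qed.

Lemma coresolving_silting : silting (underline M).
Proof.
split.
- exact: subcategory_stable coresolving_subcat coresolving_projM.
- by move=> i A B i1 [_ /lperpP lA] [HB _]; apply: lA.
- apply/seteqP; split=> // X _ N [tN MN].
  have HN := coresolving_thick_sub tN MN.
  have : check H X by rewrite checkH.
  move=> [n [K [Y [XK Kn HY KYK]]]].
  (* The coresolution is climbed from its end, where [K n = Y n] is in [H], back to [K 0], with each
     [K i] the fibre of Y i -> K (i+1). *)
  have NK m : (m <= n)%N -> N (K (n - m)%N).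
    elim: m => [|m IHm] mn; first by rewrite subn0 Kn; apply/HN/HY.
    have nm : (n - m.+1 < n)%N by rewrite ltn_subrL (leq_trans _ mn).
    have [f [g fg]] := KYK _ nm; apply: (thick_confl_fib tN fg).
      exact/HN/HY/ltnW.
    by rewrite subnSK //; apply: IHm; apply: ltnW.
  have := NK n (leqnn n); rewrite subnn.
  exact: subcat_iso (thick_subcat tN) _ _ (isomorphic_sym (stable_isomorphic XK)).
Qed.

Lemma coresolving_gen : gen M `<=` H.
Proof.
move=> A; elim=> {A} [j A [HA _]|A B D f g fg _ HA _ HD|A B X ABX _ HX].
- exact: coresolving_shift.
- exact: cores_ext fg HA HD.
- exact: subcat_summand ABX HX.
Qed.

Lemma coresolving_recover : rperp M = H.
Proof.
apply/seteqP; split=> [X|A HA].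
  rewrite silting_rperp; first exact: coresolving_gen.
  - exact: coresolving_subcat.
  - exact: coresolving_projM.
  - exact: coresolving_silting.
by apply/rperpP => i B i1 [_ /lperpP lB]; apply: lB.
Qed.

End CoresolvingToSilting.

End StableCategory.

Theorem corollary1p2 (C : frobcat) :
  inverse_bijections (@silting_class C) (@coresolving_class C)
    (fun S => rperp (ununderline S)) (fun H => underline (H `&` lperp H)).
Proof.
split.
- by move=> _ [M [subM projM -> siltM]]; apply: silting_coresolving.
- move=> H [subH envH coresH checkH boundH]; exists (H `&` lperp H); split=> //.
  + exact: coresolving_subcat.
  + exact: coresolving_projM.
  + exact: coresolving_silting.
- by move=> _ /set_mem[M [subM projM -> siltM]]; apply: silting_recover.
- by move=> H /set_mem[subH envH coresH checkH boundH]; apply: coresolving_recover.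
Qed.
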